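(* Let $\mathfrak X=(X,R_0,R_1,R_2,R_3)$ be the distance scheme of a generalized hexagon of order $(2,8)$, and let $\Lambda$ and $L_{\mathfrak X}\subset\Lambda$ be the lattices defined in the context. Then $$L_{\mathfrak X}=\Lambda^\#.$$
   Context: A generalized hexagon is a point-line incidence geometry whose incidence graph has diameter $6$ and girth $12$; it has order $(s,t)$ if every line contains $s+1$ points and every point lies on $t+1$ lines. The point graph of a generalized hexagon of order $(2,8)$ has the $819$ points $X$ as vertices, distinct collinear points being adjacent; it has diameter $3$. $R_i$ is the relation of being at distance $i$ in the point graph and $A_i$ its adjacency matrix ($A_0=I$). Put $$E=\tfrac{2}{63}\left(I-\tfrac12A_1+\tfrac14A_2-\tfrac18A_3\right),$$ the rank-$26$ primitive idempotent of the algebra spanned by the $A_i$, and $v_x=\sqrt{84}\,Ee_x$ for $x\in X$, where $e_x$ is the standard basis of $\mathbf R^X$. Thus $(v_x,v_y)=8/3,-4/3,2/3,-1/3$ for $(x,y)\in R_0,R_1,R_2,R_3$ respectively. Let $\Lambda=\langle v_x:x\in X\rangle_{\mathbf Z}$, a lattice of rank $26$, and let $$L_{\mathfrak X}=\Big\{\sum_xa_xv_x:a_x\in\mathbf Z,\ \sum_xa_x\equiv0\pmod3\Big\},$$ the kernel of the homomorphism $\Lambda\to\mathbf F_3$, $\sum a_xv_x\mapsto\sum a_x\bmod 3$ (which is well-defined). $\Lambda^\#=\{y\in\Lambda\otimes\mathbf R:(y,\Lambda)\subset\mathbf Z\}$ is the dual lattice. *)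

(* Defs.v *)
From HB Require Import structures.
From mathcomp Require Import all_boot all_order all_algebra.
From mathcomp Require Import boolp classical_sets reals.

Set Implicit Arguments.
Unset Strict Implicit.
Unset Printing Implicit Defensive.

Import Order.TTheory GRing.Theory Num.Theory.
Local Open Scope ring_scope.

Section Graphs.
Variables (T : finType) (e : rel T).

Definition has_walk (n : nat) (x y : T) : bool :=
  [exists p : n.-tuple T, path e x p && (last x p == y)].

Definition at_dist (n : nat) (x y : T) : bool :=
  has_walk n x y && [forall m : 'I_n, ~~ has_walk m x y].

Definition has_diameter (d : nat) : Prop :=
  (forall x y : T, exists2 n : nat, (n <= d)%N & at_dist n x y) /\
  (exists x y : T, at_dist d x y).

(* [ucycle e] also accepts sequences of length 0 and 2 (and 1 if there are
   loops), which are not cycles of a graph. *)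
Definition graph_cycle (c : seq T) : Prop := (3 <= size c)%N /\ ucycle e c.

Definition has_girth (g : nat) : Prop :=
  (exists2 c : seq T, graph_cycle c & size c = g) /\
  (forall c : seq T, graph_cycle c -> (g <= size c)%N).

End Graphs.

Section Geometry.
Variables (X L : finType) (inc : X -> L -> bool).

Definition incidence_graph : rel (X + L) := fun u v =>
  match u, v with
  | inl x, inr l => inc x l
  | inr l, inl x => inc x l
  | _, _ => false
  end.

Definition generalized_hexagon : Prop :=
  has_diameter incidence_graph 6 /\ has_girth incidence_graph 12.

Definition has_order (s t : nat) : Prop :=
  (forall l : L, #|[set x | inc x l]| = s.+1) /\
  (forall x : X, #|[set l | inc x l]| = t.+1).

Definition point_graph : rel X := fun x y =>
  (x != y) && [exists l : L, inc x l && inc y l].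

Definition scheme_rel (i : nat) : rel X := at_dist point_graph i.

End Geometry.

(* [R^X] is represented by column vectors of length [#|X|], the coordinate of
   index [x : X] being the one of index [enum_rank x]. *)
Section Lattices.
Variable R : realType.

Definition inner (n : nat) (u v : 'cV[R]_n) : R := \sum_(i < n) u i 0 * v i 0.

Definition real_span (n : nat) (S : set 'cV[R]_n) : set 'cV[R]_n :=
  [set y | exists (k : nat) (c : 'I_k -> R) (z : 'I_k -> 'cV[R]_n),
     (forall i, S (z i)) /\ y = \sum_(i < k) c i *: z i]%classic.

Definition dual_lattice (n : nat) (S : set 'cV[R]_n) : set 'cV[R]_n :=
  [set y | real_span S y /\ (forall z, S z -> inner y z \is a Num.int)]%classic.

Variables (X L : finType) (inc : X -> L -> bool).

Definition adj_mx (i : nat) : 'M[R]_#|X| :=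
  \matrix_(a, b) (scheme_rel inc i (enum_val a) (enum_val b))%:R.

Definition E_mx : 'M[R]_#|X| :=
  (2 / 63) *: (1%:M - 2^-1 *: adj_mx 1 + 4^-1 *: adj_mx 2 - 8^-1 *: adj_mx 3).

Definition std_basis (x : X) : 'cV[R]_#|X| := delta_mx (enum_rank x) 0.

Definition vec (x : X) : 'cV[R]_#|X| := Num.sqrt 84 *: (E_mx *m std_basis x).

Definition Lambda : set 'cV[R]_#|X| :=
  [set y | exists a : X -> int, y = \sum_x (a x)%:~R *: vec x]%classic.

Definition L_X : set 'cV[R]_#|X| :=
  [set y | exists a : X -> int,
     (\sum_x a x = 0 %[mod 3])%Z /\ y = \sum_x (a x)%:~R *: vec x]%classic.

End Lattices.

Arguments Lambda R [X L] inc _.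
Arguments L_X R [X L] inc _.

(* Main.v *)
Require Import Defs.
From mathcomp Require Import all_boot all_order all_algebra.
From mathcomp Require Import boolp classical_sets reals.
From mathcomp Require Import zify ring lra.

(** All inner products of the [v_x] are [-1/3] modulo the integers, so [L_X] is
    the set of the vectors of [Lambda] lying in the dual, and it remains to see
    that the dual is contained in [Lambda].

    Fix a point [x] on a line [l1 = {x, y, z}].  For a line [l = {p, a, b}] the
    vector [v_a - v_b] has norm 8, and it is orthogonal to [v_u] whenever [p] is
    the point of [l] nearest to [u].  Taking [v_x], these vectors for the nine
    flags on [x], and for the other eight lines on each of [y] and [z], one gets
    26 pairwise orthogonal vectors.  Bessel's inequality is an equality for each
    [v_u], so this is an orthogonal basis of the span of [Lambda] and 8 times the
    dual lies in [Lambda].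

    An odd multiple of every dual vector also lies in [Lambda]: modulo 2, the form
    [3 (v_x, v_y)] is the adjacency form of opposition (distance 3), and its rank
    is at least 26.  Indeed [x] and eight of its neighbours span a totally
    isotropic space in duality with nine further points, and orthogonally to it
    there are, for each line on [x], the sums of two points at distance 2 from [x]
    over this line.  For one line they span an isotropic space; for two lines
    they pair through a 16 x 16 sign matrix with pairwise non-proportional rows
    (Parseval for the frame), hence with rank at least 4 modulo 2, which gives
    [2 * 9 + 2 * 4 = 26]. *)

Set Implicit Arguments.
Unset Strict Implicit.
Unset Printing Implicit Defensive.

(** * Girth and distances *)

Section Walks.
Variables (T : finType) (e : rel T).

Lemma has_walk0 x y : has_walk e 0 x y = (x == y).
Proof.
apply/existsP/eqP => [[p /andP[_ /eqP <-]]|<-]; first by rewrite tuple0.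
by exists [tuple] => /=.
Qed.

Lemma has_walkS n x y :
  has_walk e n.+1 x y = [exists z, e x z && has_walk e n z y].
Proof.
apply/existsP/existsP => [[p]|[z /andP[xz /existsP[p /andP[pp lp]]]]].
  case: (tupleP p) => z q /= /andP[/andP[xz pq] lq].
  by exists z; rewrite xz; apply/existsP; exists q; rewrite pq.
by exists [tuple of z :: p] => /=; rewrite xz pp.
Qed.

Fixpoint non_backtracking (s : seq T) : bool :=
  if s is x :: s' then
    (if s' is _ :: z :: _ then x != z else true) && non_backtracking s'
  else true.

(** A return to [x] would cut off a closed walk: length 1 is excluded by irreflexivity, length 2 by
    non-backtracking, and longer ones by the girth. *)
Lemma non_backtracking_uniq g x p :
  irreflexive e -> (forall c, graph_cycle e c -> g <= size c) ->
  path e x p -> size p < g -> non_backtracking (x :: p) -> uniq (x :: p).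
Proof.
move=> irr hg; elim: p x => [//|y p IH] x /= /andP[xy yp] sp /andP[nb1 nb2].
have /= uyp := IH y yp (ltnW sp) nb2.
rewrite uyp andbT; apply/negP => xin.
have [p1 [p2 def_p]] : exists p1 p2, y :: p = p1 ++ x :: p2.
  by case/splitPr: xin => p1 p2; exists p1, p2.
have [pp up] : path e x (y :: p) /\ uniq (y :: p) by rewrite /= xy yp uyp.
have sp' : size (y :: p) < g by [].
move: pp up sp'; rewrite def_p cat_path cat_uniq size_cat.
move=> /and3P[pp1 lx _] /and3P[up1 /norP[xp1 _] _] sz.
have cyc : ucycle e (x :: p1).
  by rewrite /ucycle /= rcons_path pp1 lx xp1 up1.
case: p1 => [|a [|b p1]] in def_p lx sz cyc xp1 pp1 up1 *.
- by case: def_p xy => -> _; rewrite irr.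
- by case: def_p nb1 => _ ->; rewrite eqxx.
- have /hg : graph_cycle e [:: x, a, b & p1] by [].
  by move: sz => /=; lia.
Qed.

Lemma no_short_closed_walk g x p :
  irreflexive e -> (forall c, graph_cycle e c -> g <= size c) ->
  path e x p -> last x p = x -> 0 < size p < g ->
  non_backtracking (x :: p) -> False.
Proof.
move=> irr hg pp lp /andP[p0 pg] nb.
have := non_backtracking_uniq irr hg pp pg nb.
by case: p lp p0 {pp pg nb} => [//|y p] /= lp _; rewrite -{1}lp mem_last.
Qed.

End Walks.

(** * Distance in the point graph, compared with walks in the incidence graph *)

Section Distance.
Variables (X L : finType) (inc : X -> L -> bool).
Local Notation col := (point_graph inc).

(** A total function with default value 3; for a hexagon, [scheme_relE] identifies it with the
    distance in the point graph. *)
Definition pdist (x y : X) : nat :=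
  if x == y then 0 else if col x y then 1 else
  if [exists z, col x z && col z y] then 2 else 3.

Lemma point_graphP x y :
  reflect (x <> y /\ exists2 l, inc x l & inc y l) (col x y).
Proof.
apply: (iffP andP) => [[/eqP ? /existsP[l /andP[]]]|[/eqP ? [l xl yl]]].
  by split=> //; exists l.
by split=> //; apply/existsP; exists l; rewrite xl.
Qed.

Lemma col_sym : symmetric col.
Proof.
move=> x y; apply/point_graphP/point_graphP => -[xy [l ? ?]].
  by split; [exact: nesym | exists l].
by split; [exact: nesym | exists l].
Qed.

Lemma col_irr : irreflexive col.
Proof. by move=> x; rewrite /point_graph eqxx. Qed.

Lemma pdistxx x : pdist x x = 0. Proof. by rewrite /pdist eqxx. Qed.

Lemma pdist_sym x y : pdist x y = pdist y x.
Proof.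
rewrite /pdist eq_sym col_sym; do 2!case: ifP => // _.
by congr (if _ then _ else _);
  apply: eq_existsb => z; rewrite andbC (col_sym z y) (col_sym x z).
Qed.

Lemma pdist_le3 x y : pdist x y <= 3.
Proof. by rewrite /pdist; do 3?case: ifP. Qed.

Lemma pdist_eq0 x y : (pdist x y == 0) = (x == y).
Proof. by rewrite /pdist; do 3?case: ifP. Qed.

Lemma pdist_eq1 x y : (pdist x y == 1) = col x y.
Proof.
rewrite /pdist; case: (x =P y) => [->|_]; first by rewrite col_irr.
by do 2?case: ifP.
Qed.

Lemma pdist2_ex x y : pdist x y = 2 -> exists2 z, col x z & col z y.
Proof.
rewrite /pdist; do 3?case: ifP => //.
by move=> /existsP[z /andP[xz zy]] _ _ _; exists z.
Qed.

Lemma pdist_le2 x y z : col x z -> col z y -> pdist x y <= 2.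
Proof.
move=> xz zy; rewrite /pdist; do 3?case: ifP => //.
by move/existsP => []; exists z; rewrite xz.
Qed.

Lemma pdist_le_walk k x y : has_walk col k x y -> pdist x y <= k.
Proof.
case: k => [|[|[|k]]].
- by rewrite has_walk0 => /eqP->; rewrite pdistxx.
- rewrite has_walkS => /existsP[z]; rewrite has_walk0 => /andP[xz /eqP <-].
  by move: xz; rewrite -pdist_eq1 => /eqP->.
- rewrite has_walkS => /existsP[z]; rewrite has_walkS => /andP[xz /existsP[t]].
  by rewrite has_walk0 => /andP[zt /eqP <-]; apply: pdist_le2 zt.
- by move=> _; apply: leq_trans (pdist_le3 _ _) _.
Qed.

(** Two incidence steps from a point either return to it or make one step between collinear
    points. *)
Lemma incidence_walk n u w : has_walk (incidence_graph inc) n (inl u) w ->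
  exists k p, has_walk col k u p /\
    match w with
    | inl q => p = q /\ k.*2 <= n
    | inr l => inc p l /\ k.*2 < n
    end.
Proof.
have [N ltnN] := ubnP n; elim: N => // N IH in n u w ltnN *.
case: n => [|[|n]] in ltnN *.
- by rewrite has_walk0 => /eqP <-; exists 0, u; rewrite has_walk0.
- rewrite has_walkS => /existsP[[//|l]]; rewrite has_walk0 => /andP[ul /eqP<-].
  by exists 0, u; rewrite has_walk0.
rewrite has_walkS => /existsP[[//|l] /andP[/= ul]].
rewrite has_walkS => /existsP[[z|//] /andP[/= zl /IH]].
case=> [|k [p [wp hw]]]; first by lia.
have [uz|/eqP uz] := eqVneq u z.
  by exists k, p; rewrite uz; case: w hw => [q|m] [? ?]; split=> //; split=> //; lia.
exists k.+1, p; split.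
  rewrite has_walkS; apply/existsP; exists z; rewrite wp andbT.
  by apply/point_graphP; split=> //; exists l.
by case: w hw => [q|m] [? ?]; split=> //; lia.
Qed.

End Distance.

Arguments point_graphP {X L inc x y}.

(** * Small polygons and projections onto lines *)

Section Hexagon.
Variables (X L : finType) (inc : X -> L -> bool).
Hypothesis hhex : generalized_hexagon inc.
Local Notation col := (point_graph inc).
Local Notation d := (pdist inc).

Lemma near_point u l : exists2 p, inc p l & d u p <= 2.
Proof.
case: hhex => -[diam _] _.
have [n n6 /andP[/incidence_walk[k [p [wp [pl k2]]]] _]] := diam (inl u) (inr l).
by exists p => //; apply: leq_trans (pdist_le_walk wp) _; lia.
Qed.

Lemma pdist_walk x y : has_walk col (d x y) x y.
Proof.
case: hhex => -[diam _] _.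
have [n n6 /andP[/incidence_walk[k [p [wp [<- k2]]]] _]] := diam (inl x) (inl y).
have := pdist_le_walk wp; have := pdist_le3 inc x p.
case E : (d x p) => [|[|[|[|//]]]] _ dk.
- by rewrite has_walk0 -(pdist_eq0 inc) E.
- rewrite has_walkS; apply/existsP; exists p.
  by rewrite has_walk0 eqxx -pdist_eq1 E.
- have [z xz zp] := pdist2_ex E.
  rewrite has_walkS; apply/existsP; exists z; rewrite xz has_walkS.
  by apply/existsP; exists p; rewrite has_walk0 eqxx zp.
(* Here 3 is the default value of [pdist]; the walk itself has $3 \le k$ and $2k \le 6$. *)
- by have -> // : 3 = k by lia.
Qed.

Lemma scheme_relE i x y : scheme_rel inc i x y = (d x y == i).
Proof.
apply/andP/eqP => [[wi /forallP h]|<-].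
  have := pdist_le_walk wi; rewrite leq_eqVlt => /predU1P[//|lt].
  by have /negP[] := h (Ordinal lt); apply: pdist_walk.
split; first exact: pdist_walk.
by apply/forallP => m; apply/negP => /pdist_le_walk; rewrite leqNgt ltn_ord.
Qed.

Lemma no_closed_walk x p : path (incidence_graph inc) x p -> last x p = x ->
  0 < size p < 12 -> non_backtracking (x :: p) -> False.
Proof.
move=> pp lp sp nb; case: hhex => _ [_ girth].
apply: (no_short_closed_walk _ girth pp lp sp nb).
by case.
Qed.

Lemma line_unique x y l m : x <> y ->
  inc x l -> inc y l -> inc x m -> inc y m -> l = m.
Proof.
move=> /eqP xy xl yl xm ym; apply/eqP/negP => /negP lm.
apply: (@no_closed_walk (inl x) [:: inr l; inl y; inr m; inl x]) => //=.
  by rewrite xl yl ym xm.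
by rewrite !(inj_eq (@inl_inj _ _)) (inj_eq (@inr_inj _ _)) xy lm eq_sym xy.
Qed.

(** An ordinary k-gon with k = 3, 4 or 5 is a closed walk of $2k < 12$ steps in the incidence
    graph. *)
Lemma no_triangle u a b m1 m2 m3 : u <> a -> a <> b -> b <> u ->
  m1 <> m2 -> m2 <> m3 ->
  inc u m1 -> inc a m1 -> inc a m2 -> inc b m2 -> inc b m3 -> inc u m3 -> False.
Proof.
move=> /eqP ua /eqP ab /eqP bu /eqP m12 /eqP m23 i1 i2 i3 i4 i5 i6.
apply: (@no_closed_walk (inl u)
  [:: inr m1; inl a; inr m2; inl b; inr m3; inl u]) => //=.
  by rewrite i1 i2 i3 i4 i5 i6.
by rewrite !(inj_eq (@inl_inj _ _)) !(inj_eq (@inr_inj _ _)) ua ab bu m12 m23.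
Qed.

Lemma no_quadrangle u a b c m1 m2 m3 m4 : u <> a -> a <> b -> b <> c -> c <> u ->
  m1 <> m2 -> m2 <> m3 -> m3 <> m4 ->
  inc u m1 -> inc a m1 -> inc a m2 -> inc b m2 -> inc b m3 -> inc c m3 ->
  inc c m4 -> inc u m4 -> False.
Proof.
move=> /eqP ua /eqP ab /eqP bc /eqP cu /eqP m12 /eqP m23 /eqP m34.
move=> i1 i2 i3 i4 i5 i6 i7 i8.
apply: (@no_closed_walk (inl u)
  [:: inr m1; inl a; inr m2; inl b; inr m3; inl c; inr m4; inl u]) => //=.
  by rewrite i1 i2 i3 i4 i5 i6 i7 i8.
by rewrite !(inj_eq (@inl_inj _ _)) !(inj_eq (@inr_inj _ _)) ua ab bc cu m12 m23 m34.
Qed.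

Lemma no_pentagon u a b c e m1 m2 m3 m4 m5 :
  u <> a -> a <> b -> b <> c -> c <> e -> e <> u ->
  m1 <> m2 -> m2 <> m3 -> m3 <> m4 -> m4 <> m5 ->
  inc u m1 -> inc a m1 -> inc a m2 -> inc b m2 -> inc b m3 -> inc c m3 ->
  inc c m4 -> inc e m4 -> inc e m5 -> inc u m5 -> False.
Proof.
move=> /eqP ua /eqP ab /eqP bc /eqP ce /eqP eu /eqP m12 /eqP m23 /eqP m34 /eqP m45.
move=> i1 i2 i3 i4 i5 i6 i7 i8 i9 i10.
apply: (@no_closed_walk (inl u) [:: inr m1; inl a; inr m2; inl b; inr m3;
  inl c; inr m4; inl e; inr m5; inl u]) => //=.
  by rewrite i1 i2 i3 i4 i5 i6 i7 i8 i9 i10.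
by rewrite !(inj_eq (@inl_inj _ _)) !(inj_eq (@inr_inj _ _)) ua ab bc ce eu
  m12 m23 m34 m45.
Qed.

Lemma col_on l x y : x <> y -> inc x l -> inc y l -> d x y = 1.
Proof.
by move=> xy xl yl; apply/eqP; rewrite pdist_eq1; apply/point_graphP;
  split=> //; exists l.
Qed.

Lemma pdist_on l x y : inc x l -> inc y l -> d x y <= 1.
Proof.
move=> xl yl; have [<-|/eqP xy] := eqVneq x y; first by rewrite pdistxx.
by rewrite (@col_on l).
Qed.

(** The projection of [u] onto [l] in the sense of near polygons. *)
Definition nearest u l p :=
  inc p l /\ forall q, inc q l -> q <> p -> d u q = (d u p).+1.

(** Two points of the line at the same minimal distance 1 or 2 from [u] would close a triangle or a
    pentagon; [near_point] excludes the minimal distance 3. *)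
Lemma ex_nearest u l : exists2 p, nearest u l p & d u p <= 2.
Proof.
have [p0 p0l p02] := near_point u l.
have [p pl min_p] : exists2 p, inc p l & forall q, inc q l -> d u p <= d u q.
  by case: (@arg_minnP _ p0 (fun p => inc p l) (d u) p0l) => p; exists p.
have p2 : d u p <= 2 by apply: leq_trans (min_p _ p0l) p02.
exists p => //; split=> // q ql qp.
have le_q := min_p q ql.
have colpq : d p q = 1 by apply: (@col_on l) => //; exact: nesym.
suff : d u q <> d u p /\ d u q <= (d u p).+1 by lia.
case E: (d u p) p2 => [|[|[|//]]] _.
- have /eqP up : u == p by rewrite -(pdist_eq0 inc) E.
  by rewrite up colpq.
- have upc : col u p by rewrite -pdist_eq1 E.
  split; last by apply: pdist_le2 upc _; rewrite -pdist_eq1 colpq.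
  move/eqP; rewrite pdist_eq1 => /point_graphP[uq [m um qm]].
  have [up [k uk pk]] := point_graphP upc.
  have nul h : inc u h -> h <> l.
    by move=> uh hl; move: (min_p u); rewrite -hl uh pdistxx E => /(_ isT).
  apply: (@no_triangle u p q k l m) => //; [exact: nesym|exact: nesym|exact: nul|].
  exact: nesym (nul _ _).
- split; last exact: pdist_le3.
  move=> q2; have [a ua ap] := pdist2_ex E; have [b ub bq] := pdist2_ex q2.
  have [ua' [m1 um1 am1]] := point_graphP ua; have [ap' [m2 am2 pm2]] := point_graphP ap.
  have [ub' [m4 um4 bm4]] := point_graphP ub; have [bq' [m3 bm3 qm3]] := point_graphP bq.
  have far c : inc c l -> d u c <= 1 -> False.
    by move=> cl c1; have := leq_trans (min_p c cl) c1; rewrite E.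
  apply: (@no_pentagon u a p q b m1 m2 l m3 m4) => //; try exact: nesym.
  + by move=> m12; have := pdist_on um1 (_ : inc p m1); rewrite m12 pm2 E => /(_ isT).
  + by move=> m2l; apply: (far a); rewrite -?m2l // (pdist_on um1).
  + by move=> lm3; apply: (far b); rewrite ?lm3 // (pdist_on um4).
  + by move=> m34; have := pdist_on um4 (_ : inc q m4); rewrite -m34 qm3 q2 => /(_ isT).
Qed.

(** Two common neighbours close a triangle if they lie with [v] on one line, and a quadrangle
    otherwise. *)
Lemma common_neighbour_unique u v a b : d u v = 2 ->
  col u a -> col a v -> col u b -> col b v -> a = b.
Proof.
move=> uv2 ua av ub bv; apply/eqP/negP => /negP/eqP ab.
have [ua' [m1 um1 am1]] := point_graphP ua; have [av' [m2 am2 vm2]] := point_graphP av.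
have [ub' [m4 um4 bm4]] := point_graphP ub; have [bv' [m3 bm3 vm3]] := point_graphP bv.
have clos m : inc u m -> inc v m -> False.
  by move=> um vm; have := pdist_on um vm; rewrite uv2.
have m12 : m1 <> m2 by move=> m; apply: (clos m1); rewrite // m.
have m34 : m3 <> m4 by move=> m; apply: (clos m4); rewrite // -m.
have [m23|/eqP m23] := eqVneq m2 m3.
  by apply: (@no_triangle u a b m1 m2 m4) => //; [exact: nesym|rewrite m23|rewrite m23].
by apply: (@no_quadrangle u a v b m1 m2 m3 m4) => //; exact: nesym.
Qed.

End Hexagon.

Import Order.TTheory GRing.Theory Num.Theory.
Local Open Scope ring_scope.

(** * The Gram matrix *)

(* [3 (v_x, v_y)], which is also the entry [(x, y)] of [252 E]. *)
Definition gram_val (k : nat) : int :=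
  match k with 0 => 8 | 1 => -4 | 2 => 2 | _ => -1 end.

Section Order.
Variables (X L : finType) (inc : X -> L -> bool).
Hypothesis hhex : generalized_hexagon inc.
Hypothesis hord : has_order inc 2 8.
Local Notation col := (point_graph inc).
Local Notation d := (pdist inc).

(** The order is that of the enumeration of [X], an arbitrary choice on which the sign of
    [mate_diff] and the point [tip] depend. *)
Definition mates (p : X) (l : L) : seq X := enum [set x | inc x l & x != p].
Definition mate1 p l := nth p (mates p l) 0%N.
Definition mate2 p l := nth p (mates p l) 1%N.

Lemma matesE p l : inc p l -> mates p l = [:: mate1 p l; mate2 p l].
Proof.
move=> pl; rewrite /mate1 /mate2.
suff : size (mates p l) = 2%N by case: (mates p l) => [|a [|b []]].
rewrite -cardE; have [/(_ l) hl _] := hord.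
have := cardsD1 p [set x | inc x l]; rewrite hl inE pl => -[] ->.
by apply: eq_card => x; rewrite !inE andbC.
Qed.

Lemma in_mates p l x : (x \in mates p l) = inc x l && (x != p).
Proof. by rewrite mem_enum inE. Qed.

Variant mates_spec p l : Prop :=
  MatesSpec of inc (mate1 p l) l & inc (mate2 p l) l & mate1 p l <> p
    & mate2 p l <> p & mate1 p l <> mate2 p l
    & (forall x, inc x l -> [\/ x = p, x = mate1 p l | x = mate2 p l]).

Lemma matesP p l : inc p l -> mates_spec p l.
Proof.
move=> pl; have E := matesE pl.
have := in_mates p l (mate1 p l); have := in_mates p l (mate2 p l).
rewrite E !inE !eqxx orbT => /esym/andP[b1 /eqP b2] /esym/andP[a1 /eqP a2].
split=> //.
  have := enum_uniq [set x | inc x l & x != p].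
  by rewrite -/(mates p l) E /= inE andbT => /eqP.
move=> x xl; have [->|xp] := eqVneq x p; first by constructor 1.
have := in_mates p l x; rewrite xl xp E !inE => /orP[/eqP->|/eqP->].
  by constructor 2.
by constructor 3.
Qed.

Lemma sum_mates (V : nmodType) p l (F : X -> V) : inc p l ->
  \sum_(x | inc x l && (x != p)) F x = F (mate1 p l) + F (mate2 p l).
Proof.
move=> pl; transitivity (\sum_(x in [set x | inc x l & x != p]) F x).
  by apply: eq_bigl => x; rewrite inE.
rewrite -big_enum /= -/(mates p l) matesE // !big_cons big_nil. by rewrite addr0.
Qed.

Lemma sum_line (V : nmodType) p l (F : X -> V) : inc p l ->
  \sum_(x | inc x l) F x = F p + F (mate1 p l) + F (mate2 p l).
Proof. by move=> pl; rewrite (bigD1 p) //= sum_mates // addrA. Qed.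

Lemma sum_lines_const (V : nmodType) x (v : V) : \sum_(l | inc x l) v = v *+ 9.
Proof.
rewrite sumr_const; congr (_ *+ _); have [_ /(_ x) <-] := hord.
by apply: eq_card => l; rewrite !inE.
Qed.

Lemma sum_col (V : nmodType) x (F : X -> V) :
  \sum_(z | col x z) F z =
  \sum_(l | inc x l) \sum_(z | inc z l && (z != x)) F z.
Proof.
rewrite (exchange_big_dep (col x)) /=; last first.
  move=> l z xl /andP[zl /eqP zx].
  by apply/point_graphP; split; [exact: nesym | exists l].
apply: eq_bigr => z /point_graphP[xz [l xl zl]].
rewrite (big_pred1 l) // => m /=; apply/idP/eqP => [/and3P[xm zm _]|->].
  exact: (line_unique hhex xz).
by rewrite xl zl; apply/eqP/nesym.
Qed.

Lemma col_count x : \sum_(z | col x z) 1 = 18 :> int.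
Proof.
rewrite sum_col; under eq_bigr => l xl do rewrite sum_mates //.
by rewrite sum_lines_const.
Qed.

(** This is $A_1^2 = 18 I + A_1 + A_2$: collinear points have only the third point of their line as
    common neighbour, and points at distance 2 have a single one. *)
Lemma common_count x z :
  \sum_(y | col x y && col y z) 1 =
  (d x z == 0%N)%:R *+ 18 + (d x z == 1%N)%:R + (d x z == 2%N)%:R :> int.
Proof.
case E : (d x z) (pdist_le3 inc x z) => [|[|[|[|//]]]] _ /=.
- have /eqP <- : x == z by rewrite -(pdist_eq0 inc) E.
  apply: etrans (col_count x); apply: eq_bigl => y.
  by rewrite (col_sym inc y) andbb.
- have /point_graphP[xz [l xl zl]] : col x z by rewrite -pdist_eq1 E.
  (* As [x] and [z] are both at distance 1 from [y], the projection of [y] onto [l] is at distance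
     0, hence is [y]. *)
  have only y : col x y -> col y z -> inc y l.
    rewrite (col_sym inc x) -!pdist_eq1 => /eqP yx /eqP yz.
    have [p [pl hp] _] := ex_nearest hhex y l.
    have [xp|/eqP xp] := eqVneq x p.
      by have := hp z zl; rewrite -xp yz yx => /(_ (nesym xz)).
    by have := hp x xl xp; rewrite yx => -[] /esym/eqP; rewrite pdist_eq0 => /eqP->.
  have [y [yl yx yz hy]] : exists y, [/\ inc y l, y <> x, y <> z &
      forall w, inc w l -> [\/ w = x, w = z | w = y]].
    have [al bl ax bx ab h] := matesP xl.
    have [zx|za|zb] := h z zl; first by rewrite zx in xz.
      by exists (mate2 x l); rewrite za; split=> //; exact: nesym.
    by exists (mate1 x l); rewrite zb; split=> // w /h[->|->|->]; constructor.
  rewrite (big_pred1 y) // => w /=; apply/andP/eqP => [[xw wz]|->].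
    have /hy[wx|wz'|//] := only w xw wz.
      by move: xw; rewrite wx col_irr.
    by move: wz; rewrite wz' col_irr.
  by split; apply/point_graphP; split; [exact: nesym | exists l | | exists l].
- have [y xy yz] := pdist2_ex E.
  rewrite (big_pred1 y) // => w /=; apply/andP/eqP => [[xw wz]|->//].
  exact: (common_neighbour_unique hhex E).
- rewrite big1 // => y /andP[xy yz].
  by have := pdist_le2 xy yz; rewrite E.
Qed.

Section LineSumZero.
Variable f : X -> int.
Hypothesis f0 : forall l, \sum_(x | inc x l) f x = 0.

(** Each of the nine lines on [x] contributes [- f x], so [f] is an eigenvector of $A_1$ for
    $-9$. *)
Lemma sum_col_eigen x : \sum_(z | col x z) f z = - f x *+ 9.
Proof.
rewrite sum_col -(sum_lines_const x); apply: eq_bigr => l xl.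
by have := f0 l; rewrite (bigD1 x) //= => /eqP; rewrite addrC addr_eq0 => /eqP.
Qed.

Lemma sum_all_eigen : \sum_z f z = 0.
Proof.
suff : (\sum_z f z) *+ 9 = 0 by lia.
rewrite -sumrMnl; under eq_bigr => z _ do rewrite -(sum_lines_const z).
rewrite (exchange_big_dep xpredT) //= big1 // => l _; exact: f0.
Qed.

(** On [f], $A_1$ acts as $-9$, $A_2 = A_1^2 - 18 I - A_1$ as $72$ and the all-one matrix $J$ as
    $0$. The matrix of [gram_val] is $9 I - 3 A_1 + 3 A_2 - J$, and $9 + 27 + 216 = 252$. *)
Lemma gram_eigen x : \sum_z gram_val (d x z) * f z = 252 * f x.
Proof.
pose S k := \sum_z (d x z == k)%:R * f z.
have Sif k : S k = \sum_(z | d x z == k) f z.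
  rewrite /S [RHS]big_mkcond; apply: eq_bigr => z _.
  by case: ifP; rewrite ?mul1r ?mul0r.
have S0 : S 0%N = f x.
  rewrite Sif (big_pred1 x) // => z; rewrite pdist_eq0 eq_sym //.
have S1 : S 1%N = - f x *+ 9.
  by rewrite Sif -sum_col_eigen; apply: eq_bigl => z; rewrite pdist_eq1.
have S2 : S 0%N *+ 18 + S 1%N + S 2%N = f x *+ 81.
  transitivity (\sum_(y | col x y) \sum_(z | col y z) f z).
    rewrite (exchange_big_dep xpredT) //= /S -sumrMnl -!big_split.
    apply: eq_bigr => z _; rewrite /= -[f z in RHS]mul1r -mulr_suml common_count.
    by rewrite !mulrDl mulrnAl.
  under eq_bigr => y _ do rewrite sum_col_eigen.
  by rewrite sumrMnl sumrN sum_col_eigen; lia.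
have -> : \sum_z gram_val (d x z) * f z = S 0%N * 9 - S 1%N * 3 + S 2%N * 3 - \sum_z f z.
  rewrite /S !mulr_suml -!sumrN -!big_split /=; apply: eq_bigr => z _.
  by case: (d x z) => [|[|[|k]]] /=; ring.
rewrite sum_all_eigen; lia.
Qed.

End LineSumZero.

(** The distances on the line are $k, k+1, k+1$ with $k \le 2$, and each value of [gram_val] up to
    there is $-2$ times the next one. *)
Lemma gram_line_sum u l : \sum_(x | inc x l) gram_val (d u x) = 0.
Proof.
have [p [pl hp] p2] := ex_nearest hhex u l.
have [al bl ap bp ab _] := matesP pl.
rewrite (sum_line _ pl) (hp _ al ap) (hp _ bl bp).
by case: (d u p) p2 => [|[|[|//]]].
Qed.

(** Idempotence of $E$, scaled: the rows of $252 E$ sum to zero on lines, so [gram_eigen] applies to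
    them. *)
Lemma gram_sq x y :
  \sum_z gram_val (d x z) * gram_val (d y z) = 252 * gram_val (d x y).
Proof. by rewrite (gram_eigen (gram_line_sum y)) (pdist_sym inc y). Qed.

End Order.

(** * An orthogonal frame *)

Section Inner.
Variables (R : realType) (n : nat).
Implicit Types u v w : 'cV[R]_n.

Lemma innerC u v : inner u v = inner v u.
Proof. by apply: eq_bigr => i _; rewrite mulrC. Qed.

Lemma innerDl u v w : inner (u + v) w = inner u w + inner v w.
Proof. by rewrite -big_split; apply: eq_bigr => i _; rewrite mxE mulrDl. Qed.

Lemma innerZl c u w : inner (c *: u) w = c * inner u w.
Proof. by rewrite [RHS]mulr_sumr; apply: eq_bigr => i _; rewrite mxE mulrA. Qed.

Lemma innerDr u v w : inner w (u + v) = inner w u + inner w v.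
Proof. by rewrite ![inner w _]innerC innerDl. Qed.

Lemma innerZr c u w : inner w (c *: u) = c * inner w u.
Proof. by rewrite ![inner w _]innerC innerZl. Qed.

Lemma innerBl u v w : inner (u - v) w = inner u w - inner v w.
Proof. by rewrite -scaleN1r innerDl innerZl mulN1r. Qed.

Lemma innerBr u v w : inner w (u - v) = inner w u - inner w v.
Proof. by rewrite ![inner w _]innerC innerBl. Qed.

Lemma inner0l w : inner 0 w = 0.
Proof. by rewrite -(scale0r 0) innerZl mul0r. Qed.

Lemma inner_suml I (r : seq I) (P : pred I) (F : I -> 'cV[R]_n) w :
  inner (\sum_(i <- r | P i) F i) w = \sum_(i <- r | P i) inner (F i) w.
Proof.
by elim/big_rec2: _ => [|i a b _ <-]; rewrite ?inner0l ?innerDl.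
Qed.

Lemma inner_sumr I (r : seq I) (P : pred I) (F : I -> 'cV[R]_n) w :
  inner w (\sum_(i <- r | P i) F i) = \sum_(i <- r | P i) inner w (F i).
Proof. by rewrite innerC inner_suml; under eq_bigr do rewrite innerC. Qed.

Lemma inner_eq0 u : inner u u = 0 -> u = 0.
Proof.
move/eqP; rewrite psumr_eq0 => [/allP u0|i _]; last by rewrite -expr2 sqr_ge0.
apply/matrixP => i j; rewrite ord1 mxE; apply/eqP.
by have := u0 i (mem_index_enum _); rewrite -expr2 sqrf_eq0.
Qed.

(** The projection [s] satisfies $(u, s) = (s, s) = (u, u)$, whence $|u - s|^2 = 0$. *)
Lemma bessel_eq (I : finType) (P : pred I) (F : I -> 'cV[R]_n) (N : R) u :
  N != 0 -> (forall i, P i -> inner (F i) (F i) = N) ->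
  (forall i j, P i -> P j -> i != j -> inner (F i) (F j) = 0) ->
  inner u u = \sum_(i | P i) inner u (F i) ^+ 2 / N ->
  u = \sum_(i | P i) (inner u (F i) / N) *: F i.
Proof.
move=> N0 FN Forth uu; set s := RHS.
have us : inner u s = inner u u.
  rewrite uu inner_sumr; apply: eq_bigr => i _; rewrite innerZr; by field.
have ss : inner s s = inner u u.
  rewrite {1}/s inner_suml uu; apply: eq_bigr => i Pi.
  rewrite innerZl inner_sumr (bigD1 i) //= innerZr FN // big1 ?addr0.
    by field.
  by move=> j /andP[Pj ji]; rewrite innerZr Forth ?mulr0 // eq_sym.
apply/eqP; rewrite -subr_eq0; apply/eqP/inner_eq0.
by rewrite innerBl !innerBr (innerC s u) us ss; ring.
Qed.

End Inner.

Section Frame.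
Variables (R : realType) (X L : finType) (inc : X -> L -> bool).
Hypothesis hhex : generalized_hexagon inc.
Hypothesis hord : has_order inc 2 8.
Local Notation d := (pdist inc).
Local Notation v := (vec R inc).

Lemma E_mxE i j :
  E_mx R inc i j = (gram_val (d (enum_val i) (enum_val j)))%:~R / 252.
Proof.
rewrite !mxE !(scheme_relE hhex) -(inj_eq enum_val_inj) -(pdist_eq0 inc).
by case: (d _ _) (pdist_le3 inc (enum_val i) (enum_val j)) => [|[|[|[|//]]]] _ /=;
  field.
Qed.

Lemma vecE x i : v x i 0 = Num.sqrt 84 * E_mx R inc i (enum_rank x).
Proof. by rewrite mxE -colE mxE. Qed.

Lemma gram x y : inner (v x) (v y) = (gram_val (d x y))%:~R / 3.
Proof.
transitivity (\sum_(i < #|X|)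
    (84 / 252 ^+ 2 : R) *
    (gram_val (d x (enum_val i)) * gram_val (d y (enum_val i)))%:~R).
  apply: eq_bigr => i _; rewrite !vecE !E_mxE !enum_rankK !(pdist_sym inc (enum_val i)).
  rewrite mulrACA -expr2 sqr_sqrtr ?ler0n // rmorphM /=; by field.
rewrite (reindex _ (onW_bij _ (enum_rank_bij X))) /=.
under eq_bigr => z _ do rewrite enum_rankK.
rewrite -mulr_sumr -rmorph_sum /= gram_sq // rmorphM /=; by field.
Qed.

Definition mate_diff (p : X) (l : L) := v (mate1 inc p l) - v (mate2 inc p l).

Lemma nearest_inner u p l : nearest inc u l p -> inner (v u) (mate_diff p l) = 0.
Proof.
move=> [pl hp]; have [al bl ap bp _ _] := matesP hord pl.
by rewrite innerBr !gram (hp _ al ap) (hp _ bl bp) subrr.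
Qed.

(** Squares of the differences $4, -2, 1$ between consecutive inner products: if [p] is not the
    projection of [u], one mate is one step nearer to [u] than [p] and the other is level with
    [p]. *)
Definition mate_val (k : nat) : R := match k with 1 => 16 | 2 => 4 | _ => 1 end.

Lemma far_inner u p l : inc p l -> ~ nearest inc u l p ->
  inner (v u) (mate_diff p l) ^+ 2 = mate_val (d u p).
Proof.
move=> pl np; have [al bl ap bp ab hl] := matesP hord pl.
have [q [ql hq] q2] := ex_nearest hhex u l.
have qp : p <> q by move=> pq; apply: np; rewrite pq; split.
rewrite innerBr !gram (hq p pl qp).
have [qp'|qa|qb] := hl q ql; first by case: qp.
  rewrite -qa (hq _ bl); last by rewrite qa; exact: nesym.
  by case: (d u q) q2 => [|[|[|//]]] _ /=; field.
rewrite -qb (hq _ al); last by rewrite qb.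
by case: (d u q) q2 => [|[|[|//]]] _ /=; field.
Qed.

Lemma not_nearest u p l : inc p l -> ~ nearest inc u l p ->
  exists q, [/\ inc q l, q <> p & d u p = (d u q).+1].
Proof.
move=> pl np; have [q [ql hq] q2] := ex_nearest hhex u l.
have pq : p <> q by move=> pq; apply: np; rewrite pq; split.
by exists q; split=> //; [exact: nesym | exact: hq].
Qed.

Lemma nearest1 q p l m : l <> m -> inc p l -> inc p m -> inc q m ->
  nearest inc q l p.
Proof.
move=> lm pl pm qm; apply: contrapT => /(not_nearest pl)[r [rl rp qp]].
have := pdist_on qm pm; rewrite qp ltnS leqn0 pdist_eq0 => /eqP qr.
by apply: lm; apply: (line_unique hhex rp); rewrite // -qr.
Qed.

(** A point of [l] nearer to [q] than [p] would be a common neighbour of [q] and [p], hence [c];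
    then [l] and [m] would share two points. *)
Lemma nearest2 q c p l m m' : l <> m -> m <> m' -> inc p l -> inc p m ->
  inc c m -> inc c m' -> inc q m' -> c <> p -> q <> c ->
  nearest inc q l p /\ d q p = 2.
Proof.
move=> lm mm' pl pm cm cm' qm' cp qc.
have qp2 : d q p = 2.
  have [_ /(_ p pm)] := nearest1 mm' cm cm' qm'.
  by rewrite (col_on qc qm' cm') => ->; [|exact: nesym].
split=> //; apply: contrapT => /(not_nearest pl)[r [rl rp qp]].
have rc : r = c.
  apply: (common_neighbour_unique hhex qp2); rewrite -pdist_eq1.
  - by move: qp; rewrite qp2 => -[<-].
  - by rewrite (col_on rp rl pl).
  - by rewrite (col_on qc qm' cm').
  - by rewrite (col_on cp cm pm).
by apply: lm; apply: (line_unique hhex rp); rewrite // rc.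
Qed.

(** Only the line on [p] leading towards [u] contributes when [u] is at distance 1 or 2; at distance
    3 each of the nine lines contributes 1. *)
Definition pencil_val (k : nat) : R :=
  match k with 0 => 0 | 1 => 16 | 2 => 4 | _ => 9 end.

Lemma pencil_sum u p :
  \sum_(l | inc p l) inner (v u) (mate_diff p l) ^+ 2 = pencil_val (d u p).
Proof.
have single k l0 : inc p l0 -> d u p = k -> (0 < k < 3)%N ->
    ~ nearest inc u l0 p ->
    (forall l q, inc p l -> inc q l -> q <> p -> d u p = (d u q).+1 -> l = l0) ->
    \sum_(l | inc p l) inner (v u) (mate_diff p l) ^+ 2 = pencil_val k.
  move=> pl0 dk k3 nn only; rewrite (bigD1 l0) //= far_inner // dk big1.
    by case: k k3 {dk} => [|[|[|//]]] //= _; rewrite addr0.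
  move=> l /andP[pl /eqP ll0]; rewrite nearest_inner ?expr0n //.
  apply: contrapT => /(not_nearest pl)[q [ql qp dq]].
  exact/ll0/(only l q).
case E: (d u p) (pdist_le3 inc u p) => [|[|[|[|//]]]] _.
- rewrite big1 // => l pl; have /eqP up : u == p by rewrite -(pdist_eq0 inc) E.
  rewrite nearest_inner ?expr0n //; split=> // q ql qp.
  by rewrite E up; apply: col_on pl ql; exact: nesym.
- have /point_graphP[up [l0 ul0 pl0]] : point_graph inc u p by rewrite -pdist_eq1 E.
  apply: (single _ l0) => // [[_ /(_ u ul0 up)]|l q pl ql qp].
    by rewrite E pdistxx.
  rewrite E => -[] /esym/eqP; rewrite pdist_eq0 => /eqP uq.
  by apply: (line_unique hhex qp); rewrite // -uq.
- have [c uc cp] := pdist2_ex E.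
  have /point_graphP[cp' [l0 cl0 pl0]] := cp.
  apply: (single _ l0) => // [[_ /(_ c cl0 cp')]|l q pl ql qp].
    by move: uc; rewrite -pdist_eq1 => /eqP->; rewrite E.
  rewrite E => -[] /esym/eqP; rewrite pdist_eq1 => uq.
  have qc : q = c.
    apply: (common_neighbour_unique hhex E) => //.
    by rewrite -pdist_eq1 (col_on qp ql pl).
  by apply: (line_unique hhex qp); rewrite // qc.
- rewrite [RHS]/= -[RHS](sum_lines_const hord p); apply: eq_bigr => l pl.
  rewrite far_inner ?E //= => pn.
  have [q qn q2] := ex_nearest hhex u l.
  have [qp|/eqP qp] := eqVneq q p; first by rewrite qp E in q2.
  by have := pn.2 q qn.1 qp; rewrite E => dq; rewrite dq in q2.
Qed.

Lemma mate_diff_norm p l : inc p l -> inner (mate_diff p l) (mate_diff p l) = 8.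
Proof.
move=> /(matesP hord)[al bl _ _ ab _].
rewrite innerBl !innerBr !gram !pdistxx (col_on ab al bl) (col_on (nesym ab) bl al) /=.
by field.
Qed.

Lemma mate_diff_orth p l p' l' : inc p' l' ->
  (forall q, inc q l' -> q <> p' -> nearest inc q l p) ->
  inner (mate_diff p l) (mate_diff p' l') = 0.
Proof.
move=> pl' near; have [al bl ap bp _ _] := matesP hord pl'.
by rewrite innerBr !(innerC (mate_diff p l)) !nearest_inner ?subrr //; exact: near.
Qed.

Section Base.
Variables (x : X) (l1 : L).
Hypothesis xl1 : inc x l1.

(** Nine flags at [x], the one with [l1] included, and eight at each other point of [l1]: with [v x]
    this makes 26 vectors. *)
Definition frame (f : X * L) : bool :=
  [&& inc f.1 l1, inc f.1 f.2 & (f.1 == x) || (f.2 != l1)].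

Local Notation F := (fun f : X * L => mate_diff f.1 f.2).

Lemma sum_frame (V : nmodType) (H : X * L -> V) :
  \sum_(f | frame f) H f = \sum_(l | inc x l) H (x, l) +
    \sum_(l | inc (mate1 inc x l1) l && (l != l1)) H (mate1 inc x l1, l) +
    \sum_(l | inc (mate2 inc x l1) l && (l != l1)) H (mate2 inc x l1, l).
Proof.
have [_ _ /eqP ax /eqP bx _ _] := matesP hord xl1.
transitivity (\sum_(p | inc p l1)
    \sum_(l | inc p l && ((p == x) || (l != l1))) H (p, l)).
  by rewrite pair_big_dep /=; apply: eq_big => [] [p l].
rewrite (sum_line hord _ xl1) (negPf ax) (negPf bx) eqxx /=.
by congr (_ + _ + _); apply: eq_bigl => l; rewrite andbT.
Qed.

(** If the lines share a base point or one of them is [l1], the mates on one line project to the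
    base point of the other by [nearest1]; otherwise [nearest2] applies along [l1]. *)
Lemma frame_orth f f' : frame f -> frame f' -> f != f' ->
  inner (F f) (F f') = 0.
Proof.
case: f f' => [p l] [p' l'] /and3P[/= pl1 pl hl] /and3P[/= pl1' pl' hl'] ff'.
have [pp|/eqP pp] := eqVneq p p'.
  subst p'; apply: mate_diff_orth => // q ql' qp.
  by apply: (nearest1 _ pl pl' ql') => ll; rewrite ll eqxx in ff'.
have [ll1|/eqP ll1] := eqVneq l l1; have [ll1'|/eqP ll1'] := eqVneq l' l1.
- by move: hl hl'; rewrite ll1 ll1' eqxx !orbF => /eqP px /eqP px'; case: pp; rewrite px.
- rewrite innerC; apply: mate_diff_orth => // q; rewrite ll1 => ql1 _.
  exact: (nearest1 ll1' pl').
- apply: mate_diff_orth => // q; rewrite ll1' => ql1 _.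
  exact: (nearest1 ll1 pl).
- apply: mate_diff_orth => // q ql' qp.
  have [] // := @nearest2 q p' p l l1 l' => //; exact: nesym.
Qed.

Lemma frame_base f : frame f -> inner (v x) (F f) = 0.
Proof.
case: f => [p l] /and3P[/= pl1 pl hl]; apply: nearest_inner.
have [px|/eqP px] := eqVneq p x.
  subst p; split=> // q ql qx; rewrite pdistxx; apply: col_on pl ql; exact: nesym.
case/predU1P: hl => [//|/eqP ll1]; exact: (nearest1 ll1 pl pl1 xl1).
Qed.

(** The weights are the inverses of the norms $8/3$ and $8$. Everything depends only on the
    projection of [u] onto [l1] and on its distance, which leaves a finite check. *)
Lemma frame_parseval u :
  inner (v u) (v u) =
  3 / 8 * inner (v u) (v x) ^+ 2 + \sum_(f | frame f) inner (v u) (F f) ^+ 2 / 8.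
Proof.
have [al bl /eqP ax /eqP bx ab hl] := matesP hord xl1.
rewrite -mulr_suml sum_frame /=.
(* The full pencil at [p] contains [l1], which the frame keeps at [x] only. *)
have tail p : inc p l1 ->
    \sum_(l | inc p l && (l != l1)) inner (v u) (mate_diff p l) ^+ 2 =
    pencil_val (d u p) - inner (v u) (mate_diff p l1) ^+ 2.
  by move=> pl1; rewrite -pencil_sum [in RHS](bigD1 l1) //= addrC addrK.
rewrite !tail // pencil_sum !gram pdistxx.
have [q [ql hq] q2] := ex_nearest hhex u l1.
have val p : inc p l1 -> p <> q -> d u p = (d u q).+1 /\
    inner (v u) (mate_diff p l1) ^+ 2 = mate_val (d u q).+1.
  move=> pl pq; have dp := hq p pl pq; split=> //.
  by rewrite far_inner ?dp // => -[_ /(_ q ql (nesym pq))]; rewrite dp; lia.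
have vq : inner (v u) (mate_diff q l1) ^+ 2 = 0.
  by rewrite nearest_inner ?expr0n.
have [qx|qa|qb] := hl q ql.
- subst x; have [-> ->] := val _ al (elimN eqP ax).
  have [-> ->] := val _ bl (elimN eqP bx).
  by case: (d u q) q2 => [|[|[|//]]] _ /=; field.
- rewrite -qa vq; have [-> ->] := val _ bl ltac:(by rewrite qa => /esym).
  have [-> _] := val _ xl1 ltac:(by rewrite qa => xa; rewrite -xa eqxx in ax).
  by case: (d u q) q2 => [|[|[|//]]] _ /=; field.
- rewrite -qb vq; have [-> ->] := val _ al ltac:(by rewrite qb).
  have [-> _] := val _ xl1 ltac:(by rewrite qb => xa; rewrite -xa eqxx in bx).
  by case: (d u q) q2 => [|[|[|//]]] _ /=; field.
Qed.

Definition frame_proj y : 'cV[R]_#|X| :=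
  (3 / 8 * inner y (v x)) *: v x +
  \sum_(f | frame f) (inner y (F f) / 8) *: F f.

Lemma frame_vec u : v u = frame_proj (v u).
Proof.
rewrite /frame_proj; set c := _ * _; pose w := v u - c *: v x.
(* Removing the component along [v x] leaves frame vectors of the common norm 8, as [bessel_eq]
   requires. *)
suff -> : \sum_(f | frame f) (inner (v u) (F f) / 8) *: F f = w.
  by rewrite addrC subrK.
have wF f : frame f -> inner w (F f) = inner (v u) (F f).
  by move=> ff; rewrite innerBl (innerZl c) [inner (v x) _](frame_base ff) mulr0 subr0.
rewrite [RHS](@bessel_eq _ _ _ frame F 8) ?pnatr_eq0 //.
- by apply: eq_bigr => f ff; rewrite wF.
- by case=> p l /and3P[/= _ pl _]; exact: mate_diff_norm.
- exact: frame_orth.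
under eq_bigr => f ff do rewrite wF //.
rewrite innerBl !innerBr !(innerZl c) !(innerZr c) frame_parseval (innerC (v x) (v u)).
rewrite [inner (v x) (v x)]gram pdistxx /c /=; by field.
Qed.

Lemma frame_span (r : X -> R) :
  let y := \sum_z r z *: v z in y = frame_proj y.
Proof.
move=> y; rewrite /frame_proj.
have -> : \sum_(f | frame f) (inner y (F f) / 8) *: F f =
    \sum_(f | frame f) \sum_z (r z * (inner (v z) (F f) / 8)) *: F f.
  apply: eq_bigr => f _; rewrite inner_suml mulr_suml scaler_suml.
  by apply: eq_bigr => z _; rewrite (innerZl (r z)) mulrA.
rewrite inner_suml mulr_sumr scaler_suml exchange_big -big_split /=.
apply: eq_bigr => z _; rewrite {1}[v z]frame_vec /frame_proj scalerDr scaler_sumr.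
rewrite (innerZl (r z)) scalerA; congr (_ *: _ + _); first by ring.
by apply: eq_bigr => f _; rewrite scalerA.
Qed.

End Base.
End Frame.

(** * Rank of the opposition form modulo 2 *)

Section MatrixRank.
Variable K : fieldType.

Lemma rank_factor m n r (A : 'M[K]_(m, n)) : (r <= \rank A)%N ->
  exists U U', U *m A *m U' = 1%:M :> 'M_r.
Proof.
move=> rA; exists (pid_mx r *m invmx (col_ebase A)), (invmx (row_ebase A) *m pid_mx r).
rewrite -{2}(mulmx_ebase A) !mulmxA mulmxKV ?col_ebase_unit //.
rewrite mulmxK ?row_ebase_unit // !mul_pid_mx.
have rn := leq_trans rA (rank_leq_col A); have rm := leq_trans rA (rank_leq_row A).
by rewrite (minn_idPl rA) (minn_idPr rm) minnn (minn_idPr rn) pid_mx_1.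
Qed.

(** A relation among the rows of [U *m B], paired with [A], [T], [S], [D] in this order, loses its
    coefficients on [D], [S], [T], [A] in turn. *)
Lemma rank_hyperbolic n a s (B : 'M[K]_n) (A D : 'M_(a, n)) (S T : 'M_(s, n)) :
  B^T = B -> A *m B *m A^T = 0 -> S *m B *m A^T = 0 -> T *m B *m A^T = 0 ->
  S *m B *m S^T = 0 -> T *m B *m T^T = 0 -> S *m B *m T^T = 1%:M ->
  A *m B *m D^T \in unitmx ->
  (a + (s + (s + a)) <= \rank B)%N.
Proof.
move=> Bs AA SA TA SS TT ST AD.
have swap p q (M : 'M_(p, n)) (N : 'M_(q, n)) : N *m B *m M^T = (M *m B *m N^T)^T.
  by rewrite !trmx_mul trmxK Bs mulmxA.
pose U := col_mx A (col_mx S (col_mx T D)).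
suff : row_free (U *m B) by move/eqP <-; exact: mxrankM_maxr.
apply: inj_row_free => v.
rewrite -[v]hsubmxK -[rsubmx v]hsubmxK -[rsubmx (rsubmx v)]hsubmxK.
set al := lsubmx v; set si := lsubmx _; set ta := lsubmx _; set de := rsubmx _.
rewrite mulmxA !mul_row_col => v0.
have test m (M : 'M_(m, n)) : al *m (A *m B *m M^T) + (si *m (S *m B *m M^T) +
    (ta *m (T *m B *m M^T) + de *m (D *m B *m M^T))) = 0.
  by have := congr1 (mulmx^~ M^T) v0; rewrite mul0mx !mulmxDl !mulmxA.
have de0 : de = 0.
  have := test _ A; rewrite AA SA TA !mulmx0 !add0r swap.
  move/(congr1 (mulmx^~ (invmx (A *m B *m D^T)^T))).
  by rewrite mul0mx mulmxK // unitmx_tr.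
have si0 : si = 0.
  have := test _ T; rewrite (swap _ _ T A) TA TT ST de0 trmx0.
  by rewrite !mulmx0 mul0mx mulmx1 add0r !addr0.
have ta0 : ta = 0.
  have := test _ S; rewrite (swap _ _ S A) SA SS (swap _ _ S T) ST de0 si0.
  by rewrite trmx0 trmx1 !mulmx0 !mul0mx mulmx1 !add0r addr0.
have := test _ D; rewrite si0 ta0 de0 !mul0mx !addr0.
move/(congr1 (mulmx^~ (invmx (A *m B *m D^T)))); rewrite mul0mx mulmxK // => ->.
by rewrite !row_mx0.
Qed.

End MatrixRank.

(** A row is determined by its [\rank C] coordinates in a basis of the row space. *)
Lemma card_distinct_rows (K : finFieldType) m n (C : 'M[K]_(m, n)) (A : {set 'I_m}) :
  {in A &, injective (fun i => row i C)} -> (#|A| <= #|K| ^ \rank C)%N.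
Proof.
move=> injC.
have h i : row i C *m pinvmx (row_base C) *m row_base C = row i C.
  by rewrite mulmxKpV // eq_row_base row_sub.
rewrite -[\rank C]mul1n -card_mx.
rewrite -(card_in_imset (f := fun i => row i C *m pinvmx (row_base C))).
  exact: max_card.
by move=> i j iA jA /= eq; apply: injC => //; rewrite -(h i) -(h j) eq.
Qed.

(** * Flags around two lines on a point: inner products and opposition *)

Section ModTwo.
Variables (R : realType) (X L : finType) (inc : X -> L -> bool).
Hypothesis hhex : generalized_hexagon inc.
Hypothesis hord : has_order inc 2 8.
Local Notation d := (pdist inc).

Section Tail.
Variables (x : X).

Definition tail l1 (f : X * L) : bool :=
  [&& inc f.1 l1, inc f.1 f.2, f.1 != x & f.2 != l1].

Definition tip (f : X * L) : X := mate1 inc f.1 f.2.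

Lemma tail_frame l1 f : tail l1 f -> frame inc x l1 f.
Proof. by case/and4P=> i1 i2 _ i3; apply/and3P; split; rewrite // i3 orbT. Qed.

Lemma tipP l1 f : tail l1 f -> inc (tip f) f.2 /\ tip f <> f.1.
Proof. by case/and4P=> _ i2 _ _; have [? _ ? _ _ _] := matesP hord i2. Qed.

Section OneLine.
Variables (l1 : L) (f : X * L) (q : X).
Hypotheses (xl1 : inc x l1) (tf : tail l1 f) (qf : inc q f.2) (qn : q <> f.1).

Lemma tail_nearest : nearest inc q l1 f.1 /\ d q f.1 = 1%N.
Proof.
case/and4P: tf => pl1 pl _ /eqP ll1; split.
  exact: (nearest1 hhex (nesym ll1) pl1 pl qf).
exact: col_on qn qf pl.
Qed.

Lemma tail_base : d q x = 2%N.
Proof.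
have [[_ h] q1] := tail_nearest; case/and4P: tf => _ _ /eqP px _.
by rewrite (h x xl1 (nesym px)) q1.
Qed.

Lemma tail_near y : inc y l1 -> (d q y <= 2)%N.
Proof.
move=> yl1; have [[_ h] q1] := tail_nearest.
by have [->|/eqP yf] := eqVneq y f.1; [rewrite q1 | rewrite (h y yl1 yf) q1].
Qed.

Lemma tail_far m y : inc x m -> m <> l1 -> inc y m -> y <> x -> d q y = 3%N.
Proof.
move=> xm ml1 ym yx; case/and4P: tf => pl1 pl /eqP px /eqP ll1.
have [[_ h] q2] := nearest2 hhex ml1 (nesym ll1) xm xl1 pl1 pl qf px qn.
by rewrite (h y ym yx) q2.
Qed.

End OneLine.

(** Tips over one base point have it as a common neighbour; over different base points the path
    along [l1] is geodesic. *)
Lemma tail_tip l1 f f' : inc x l1 -> tail l1 f -> tail l1 f' ->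
  (d (tip f) (tip f') == 3%N) = (f.1 != f'.1).
Proof.
move=> xl1 tf tf'; have [wf nf] := tipP tf; have [wf' nf'] := tipP tf'.
case/and4P: (tf) => pl1 pl px /eqP ll1; case/and4P: (tf') => pl1' pl' px' /eqP ll1'.
have [pp|/eqP pp] := eqVneq f.1 f'.1.
  rewrite -pp in nf' pl'; apply/negbTE; rewrite neq_ltn ltnS.
  rewrite (@pdist_le2 _ _ inc _ _ f.1) // -pdist_eq1.
    by rewrite (col_on nf wf pl).
  by rewrite (col_on (nesym nf') pl' wf').
have [[_ h] q2] := nearest2 hhex ll1 (nesym ll1') pl pl1 pl1' pl' wf' (nesym pp) nf'.
by rewrite pdist_sym (h _ wf nf) q2.
Qed.

Lemma sum_tail (V : nmodType) l1 (H : X * L -> V) : inc x l1 ->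
  \sum_(f | tail l1 f) H f =
    \sum_(l | inc (mate1 inc x l1) l && (l != l1)) H (mate1 inc x l1, l) +
    \sum_(l | inc (mate2 inc x l1) l && (l != l1)) H (mate2 inc x l1, l).
Proof.
move=> xl1; have [al bl /eqP ax /eqP bx ab _] := matesP hord xl1.
transitivity (\sum_(f | frame inc x l1 f) if f.1 != x then H f else 0).
  rewrite -big_mkcondr; apply: eq_bigl => -[p l]; rewrite /frame /tail /=.
  by case: (p == x); rewrite /= ?andbF ?andbT.
by rewrite sum_frame //= eqxx ax bx big1 ?add0r.
Qed.

Lemma sum_tail_const (V : nmodType) l1 (v : V) : inc x l1 ->
  \sum_(f | tail l1 f) v = v *+ 16.
Proof.
move=> xl1; rewrite (sum_tail _ xl1).
have card8 p : inc p l1 -> #|[set l | inc p l & l != l1]| = 8%N.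
  move=> pl1; have [_ /(_ p)] := hord; rewrite (cardsD1 l1) inE pl1 => -[<-].
  by apply: eq_card => l; rewrite !inE andbC.
have sum8 p : inc p l1 -> \sum_(l | inc p l && (l != l1)) v = v *+ 8.
  move=> /card8 <-; rewrite -sumr_const; apply: eq_bigl => l; by rewrite inE.
have [al bl _ _ _ _] := matesP hord xl1.
by rewrite !sum8 // -mulrnDr.
Qed.

Lemma card_tail l1 : inc x l1 -> #|[set f | tail l1 f]| = 16%N.
Proof.
move=> xl1; have := sum_tail_const (1%N : nat) xl1; rewrite sum_nat_const.
by rewrite cardsE muln1.
Qed.

(** In the 2 x 2 table of distances between the mates of [f] and those of [g], each row and column
    has one 2 and one 3, so the entry of the tips fixes the sign. *)
Lemma tail_inner l1 l2 f g : l1 <> l2 -> inc x l1 -> inc x l2 ->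
  tail l1 f -> tail l2 g ->
  inner (mate_diff R inc f.1 f.2) (mate_diff R inc g.1 g.2) =
  if d (tip f) (tip g) == 3%N then -2 else 2.
Proof.
move=> l12 xl1 xl2 tf tg.
(* Since [q] is at distance 3 from [h.1], its projection onto [h.2] is one of the two mates, at
   distance 2. *)
have side h h' m m' q : m <> m' -> inc x m -> inc x m' -> tail m h -> tail m' h' ->
    inc q h'.2 -> q <> h'.1 ->
    d q (mate1 inc h.1 h.2) = 2%N /\ d q (mate2 inc h.1 h.2) = 3%N \/
    d q (mate1 inc h.1 h.2) = 3%N /\ d q (mate2 inc h.1 h.2) = 2%N.
  move=> mm' xm xm' th th' qh' qn; case/and4P: (th) => pm pl /eqP px /eqP lm.
  have qp := tail_far xm' th' qh' qn xm mm' pm px.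
  have [al bl ap bp ab hl] := matesP hord pl.
  have [r [rl rp]] : exists q', [/\ inc q' h.2, q' <> h.1 & d q h.1 = (d q q').+1].
    apply: (not_nearest hhex pl) => -[_ /(_ _ al ap)]; rewrite qp => E.
    by have := pdist_le3 inc q (mate1 inc h.1 h.2); rewrite E.
  rewrite qp => -[/esym qr].
  have [s [sl hs] s2] := ex_nearest hhex q h.2.
  have rs : r = s.
    apply: contrapT => rs; have := hs r rl rs; rewrite qr => -[/esym s1].
    have sp : h.1 <> s by move=> ps; rewrite -ps qp in s1.
    by have := hs h.1 pl sp; rewrite qp s1.
  subst s; have [//|ra|rb] := hl r rl.
    by left; rewrite -ra qr (hs _ bl) ?qr // ra; exact: nesym.
  by right; rewrite -rb qr (hs _ al) ?qr // rb.
case/and4P: (tf) => _ pl _ _; case/and4P: (tg) => _ pl' _ _.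
have [al bl ap bp ab _] := matesP hord pl.
have [al' bl' ap' bp' ab' _] := matesP hord pl'.
have := side f g _ _ _ l12 xl1 xl2 tf tg al' ap'.
have := side f g _ _ _ l12 xl1 xl2 tf tg bl' bp'.
have := side g f _ _ _ (nesym l12) xl2 xl1 tg tf al ap.
rewrite /tip innerBl !innerBr !gram // ![d (mate1 inc g.1 g.2) _]pdist_sym
  ![d (mate2 inc g.1 g.2) _]pdist_sym.
by case=> -[-> ->] [] [] // _ -> [] [] // _ -> /=; field.
Qed.

(** If two rows of the sign matrix agreed up to a global sign, Parseval in the frame of [l2] would
    give $\pm 16/2$ as the product of two orthogonal vectors. *)
Lemma tail_distinct l1 l2 f f' : l1 <> l2 -> inc x l1 -> inc x l2 ->
  tail l1 f -> tail l1 f' -> f <> f' ->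
  ~ exists c : bool, forall g, tail l2 g ->
    (d (tip f) (tip g) == 3%N) (+) (d (tip f') (tip g) == 3%N) = c.
Proof.
move=> l12 xl1 xl2 tf tf' ff' [c hc].
pose D (f : X * L) := mate_diff R inc f.1 f.2.
have D0 : inner (D f) (D f') = 0.
  by apply: (frame_orth R hhex hord (x := x) (l1 := l1));
     [exact: tail_frame | exact: tail_frame | exact/eqP].
have Dx h : tail l1 h -> inner (D h) (vec R inc x) = 0.
  by move=> th; rewrite innerC; exact: (frame_base R hhex hord xl1 (tail_frame th)).
have Dl h l : tail l1 h -> inc x l -> inner (D h) (mate_diff R inc x l) = 0.
  move=> th xl; apply: (frame_orth R hhex hord (x := x) (l1 := l1) (f' := (x, l))).
  - exact: tail_frame.
  - by rewrite /frame /= xl1 xl eqxx.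
  - by apply: contraTneq th => ->; rewrite /tail eqxx !andbF.
have Dspan : D f = frame_proj inc x l2 (D f).
  pose r z : R := (z == mate1 inc f.1 f.2)%:R - (z == mate2 inc f.1 f.2)%:R.
  have -> : D f = \sum_z r z *: vec R inc z.
    rewrite /r; under eq_bigr => z _ do rewrite scalerBl.
    rewrite sumrB (bigD1 (mate1 inc f.1 f.2)) //= eqxx scale1r big1 ?addr0; last first.
      by move=> z /negPf->; rewrite scale0r.
    rewrite (bigD1 (mate2 inc f.1 f.2)) //= eqxx scale1r big1 ?addr0 //.
    by move=> z /negPf->; rewrite scale0r.
  exact: (frame_span hhex hord xl2).
have : inner (D f') (D f) = \sum_(g | tail l2 g) (-1) ^+ c / 2.
  rewrite Dspan /frame_proj innerDr (innerZr (_ * _)) (Dx f' tf') mulr0 add0r inner_sumr.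
  rewrite (sum_frame hord xl2) (sum_tail _ xl2) /= big1 ?add0r; last first.
    by move=> l xl; rewrite (innerZr (_ / _)) (Dl f' l tf' xl) mulr0.
  have [al bl /eqP ax /eqP bx _ _] := matesP hord xl2.
  (* Each of the sixteen terms is $(\pm 2)(\pm 2)/8$, with the sign prescribed by [c]. *)
  have term p l : inc p l2 -> p != x -> inc p l && (l != l2) ->
      inner (D f') ((inner (D f) (mate_diff R inc p l) / 8) *: mate_diff R inc p l) =
      (-1) ^+ c / 2.
    move=> pl2 px /andP[pl ll2].
    have tg : tail l2 (p, l) by rewrite /tail /= pl2 pl px.
    rewrite (innerZr (_ / _)).
    rewrite (tail_inner l12 xl1 xl2 tf tg) (tail_inner l12 xl1 xl2 tf' tg).
    rewrite -(hc _ tg).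
    by case: (_ == _); case: (_ == _); rewrite /= ?expr0 ?expr1; field.
  by congr (_ + _); apply: eq_bigr => l /term; apply.
rewrite innerC D0 (sum_tail_const _ xl2); case: (c); rewrite ?expr0 ?expr1; lra.
Qed.

End Tail.
End ModTwo.

(** * The opposition form over the field of two elements *)

Section Opposite.
Variables (X L : finType) (inc : X -> L -> bool).
Hypothesis hhex : generalized_hexagon inc.
Hypothesis hord : has_order inc 2 8.
Local Notation d := (pdist inc).
Local Notation n := #|X|.

Definition opp_mx : 'M['F_2]_n :=
  \matrix_(i, j) (d (enum_val i) (enum_val j) == 3%N)%:R.

Definition pt (z : X) : 'rV['F_2]_n := delta_mx 0 (enum_rank z).

Definition form (p q : 'rV['F_2]_n) : 'F_2 := (p *m opp_mx *m q^T) 0 0.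

Lemma opp_mx_sym : opp_mx^T = opp_mx.
Proof. by apply/matrixP => i j; rewrite !mxE pdist_sym. Qed.

Lemma form_pt z w : form (pt z) (pt w) = (d z w == 3%N)%:R.
Proof.
rewrite /form /pt trmx_delta -rowE -colE mxE mxE mxE.
by rewrite !enum_rankK.
Qed.

Lemma formDl p q r : form (p + q) r = form p r + form q r.
Proof. by rewrite /form !mulmxDl mxE. Qed.

Lemma formDr p q r : form r (p + q) = form r p + form r q.
Proof. by rewrite /form linearD mulmxDr mxE. Qed.

Lemma form0l p : form 0 p = 0.
Proof. by rewrite /form !mul0mx mxE. Qed.

Lemma form0r p : form p 0 = 0.
Proof. by rewrite /form trmx0 mulmx0 mxE. Qed.

Lemma form_rows k m (A : 'M_(k, n)) (D : 'M_(m, n)) i j :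
  (A *m opp_mx *m D^T) i j = form (row i A) (row j D).
Proof. rewrite /form tr_row -row_mul [LHS]mxE [RHS]mxE; apply: eq_bigr => o _.
by rewrite [row _ _ _ _]mxE [col _ _ _ _]mxE. Qed.

Lemma F2_double (a : 'F_2) : a + a = 0.
Proof. by case: a => -[|[|//]] h; apply/val_inj. Qed.

Section Base.
Variable x : X.

(* A tip is not orthogonal to the points collinear with [x], but the sum of two
   tips over the same line is: hence the base tail [f0]. *)
Definition tails_mx l1 f0 : 'M['F_2]_(#|{: X * L}|, n) :=
  \matrix_i (if tail inc x l1 (enum_val i)
     then pt (tip inc (enum_val i)) + pt (tip inc f0) else 0).

Lemma ex_line : exists l, inc x l.
Proof.
have [_ /(_ x) c9] := hord; have : (0 < #|[set l | inc x l]|)%N by rewrite c9.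
by case/card_gt0P => l; rewrite inE; exists l.
Qed.

Lemma ex_other_line p l : exists2 m, inc p m & m <> l.
Proof.
have [_ /(_ p)] := hord; rewrite (cardD1 l) => card9.
have : (0 < #|[predD1 [set m | inc p m] & l]|)%N.
  by rewrite lt0n; apply/eqP => c0; move: card9; rewrite c0 addn0; case: (_ \in _).
by case/card_gt0P => m; rewrite !inE => /andP[/eqP ml pm]; exists m.
Qed.

Lemma ex_tail l1 : inc x l1 -> exists f0, tail inc x l1 f0.
Proof.
move=> xl1; have [al _ ax _ _ _] := matesP hord xl1.
have [m am /eqP ml] := ex_other_line (mate1 inc x l1) l1.
by exists (mate1 inc x l1, m); rewrite /tail /= al am ml (introN eqP ax).
Qed.

(** Among three flags on two base points, the number of pairs with different base points is even. *)
Lemma form_tail_self l1 f0 i j : inc x l1 -> tail inc x l1 f0 ->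
  form (row i (tails_mx l1 f0)) (row j (tails_mx l1 f0)) = 0.
Proof.
move=> xl1 tf0; rewrite !rowK.
case: ifP => [tf|_]; last exact: form0l; case: ifP => [tg|_]; last exact: form0r.
rewrite !formDl !formDr !form_pt !(tail_tip hhex hord xl1) //.
have [al bl ax bx ab hl] := matesP hord xl1.
have two p : inc p l1 && (p != x) -> p = mate1 inc x l1 \/ p = mate2 inc x l1.
  by case/andP=> /hl[->|->|->]; rewrite ?eqxx; auto.
have tl f : tail inc x l1 f -> f.1 = mate1 inc x l1 \/ f.1 = mate2 inc x l1.
  by case/and4P=> i1 _ i2 _; apply: two; rewrite i1.
have abF : mate1 inc x l1 == mate2 inc x l1 = false by apply/eqP.
by case: (tl _ tf) => ->; case: (tl _ tg) => ->; case: (tl _ tf0) => ->;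
  rewrite ?eqxx ?abF ?[mate2 inc x l1 == _]eq_sym ?abF /=; apply/val_inj.
Qed.

(** A point on a line through [x] is opposite to all tips over [l1] or to none, so the two terms
    cancel. *)
Lemma form_tail_near l1 f0 m i y : inc x l1 -> tail inc x l1 f0 ->
  inc x m -> inc y m -> form (row i (tails_mx l1 f0)) (pt y) = 0.
Proof.
move=> xl1 tf0 xm ym; rewrite rowK.
case: ifP => [tf|_]; last exact: form0l.
rewrite formDl !form_pt.
have [wf nf] := tipP hord tf; have [wf0 nf0] := tipP hord tf0.
have [->|/eqP yx] := eqVneq y x.
  by rewrite (tail_base hhex xl1 tf wf nf) (tail_base hhex xl1 tf0 wf0 nf0) addr0.
have [ml|/eqP ml] := eqVneq m l1.
  rewrite ml in ym.
  have not3 q : (d q y <= 2)%N -> (d q y == 3%N) = false.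
    by move=> le2; rewrite ltn_eqF.
  rewrite (not3 _ (tail_near hhex tf wf nf ym)).
  by rewrite (not3 _ (tail_near hhex tf0 wf0 nf0 ym)) addr0.
rewrite (tail_far hhex xl1 tf wf nf xm ml ym yx).
by rewrite (tail_far hhex xl1 tf0 wf0 nf0 xm ml ym yx) F2_double.
Qed.

(** The sixteen rows indexed by tails are distinct by [tail_distinct], whose Parseval argument runs
    over [R]; sixteen rows over two elements need rank at least 4. *)
Lemma tails_rank (R : realType) l1 l2 f0 g0 : inc x l1 -> inc x l2 -> l1 <> l2 ->
  tail inc x l1 f0 -> tail inc x l2 g0 ->
  (4 <= \rank (tails_mx l1 f0 *m opp_mx *m (tails_mx l2 g0)^T))%N.
Proof.
move=> xl1 xl2 l12 tf0 tg0; set C := _ *m _.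
pose A := [set enum_rank f | f in [set f | tail inc x l1 f]].
have cA : #|A| = 16%N.
  by rewrite card_imset ?(card_tail hord xl1) //; exact: enum_rank_inj.
have : (16 <= 2 ^ \rank C)%N; last by rewrite -[16%N]/(2 ^ 4)%N leq_exp2l.
rewrite -cA -[X in (_ <= X ^ _)%N](card_Fp (isT : prime 2)).
apply: card_distinct_rows => _ _ /imsetP[f + ->] /imsetP[f' + ->].
rewrite !inE => tf tf' eqC; apply/eqP/negP => /negP.
rewrite (inj_eq enum_rank_inj) => /eqP ff'.
apply: (@tail_distinct R _ _ _ hhex hord _ _ _ _ _ l12 xl1 xl2 tf tf' ff').
(* The base tail [f0] drops out when the two rows are compared, and [g0] leaves this constant. *)
exists ((d (tip inc f) (tip inc g0) == 3%N) (+)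
        (d (tip inc f') (tip inc g0) == 3%N)) => g tg.
have := congr1 (fun v : 'rV_ _ => v 0 (enum_rank g)) eqC.
rewrite ![row _ C 0 _]mxE !form_rows !rowK !enum_rankK tf tf' tg.
rewrite !formDl !formDr !form_pt.
by do 6!case: (_ == 3%N) => //=.
Qed.

End Base.
End Opposite.

(** Modulo 2 the matrix is $J + I$, and $(J + I)^2 = J^2 + I = I$ because $J^2 = 8 J = 0$. *)
Lemma all_ones_sub1_unit : \matrix_(i < 8, j < 8) (i != j)%:R \in @unitmx 'F_2 8.
Proof.
set K := \matrix_(_, _) _.
have dbl m n (A : 'M['F_2]_(m, n)) : A + A = 0.
  by apply/matrixP => i j; rewrite !mxE F2_double.
have KE : K = const_mx 1 + 1%:M.
  by apply/matrixP => i j; rewrite !mxE; case: eqP => _; apply/val_inj.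
have : K *m K = 1%:M.
  rewrite KE mulmxDl !mulmxDr !mul1mx mulmx1 addrA -(addrA (_ *m _)) dbl addr0.
  have -> : (const_mx 1 : 'M['F_2]_8) *m const_mx 1 = 0 :> 'M['F_2]_8.
    apply/matrixP => i j; rewrite !mxE; under eq_bigr do rewrite !mxE mulr1.
    by rewrite sumr_const card_ord; apply/val_inj.
  by rewrite add0r.
by case/mulmx1_unit.
Qed.

(** * Lower bound for the rank of opposition *)

Section OppRank.
Variables (R : realType) (X L : finType) (inc : X -> L -> bool).
Hypothesis hhex : generalized_hexagon inc.
Hypothesis hord : has_order inc 2 8.
Local Notation d := (pdist inc).
Local Notation n := #|X|.

(** The points [u] and [q] are to be dual to [x] and [y]. Eight of the nine lines are taken because
    $J - I$ is singular modulo 2 in odd order. *)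
Variant dual_points x : Prop :=
  DualPoints (y q : 'I_8 -> X) u of
    (forall i, exists2 l, inc x l & inc (y i) l)
  & (forall i, d x (q i) = 2%N)
  & (forall i j, (d (y i) (q j) == 3%N) = (i != j)) & d x u = 3%N.

Lemma dual_pointsP x : dual_points x.
Proof.
have [l0 xl0] := ex_line hord x.
pose ls := enum [set l | inc x l]; pose ln (i : 'I_8) := nth l0 ls i.
have sls : size ls = 9%N by rewrite -cardE; case: hord.
have xln i : inc x (ln i).
  have : ln i \in ls by rewrite mem_nth // sls ltnW // ltnS ltn_ord.
  by rewrite mem_enum inE.
have ln_inj i j : ln i = ln j -> i = j.
  move/eqP; rewrite nth_uniq ?enum_uniq ?sls ?ltnS ?(ltnW (ltn_ord _)) //.
  by move/eqP/val_inj.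
pose y i := mate1 inc x (ln i).
have yP i : inc (y i) (ln i) /\ y i <> x by have [? _ ? _ _ _] := matesP hord (xln i).
have /fin_all_exists2[m ym mln] i := ex_other_line hord (y i) (ln i).
pose q i := mate1 inc (y i) (m i).
have qP i : inc (q i) (m i) /\ q i <> y i by have [? _ ? _ _ _] := matesP hord (ym i).
have far i l : inc x l -> l <> ln i -> nearest inc (q i) l x /\ d (q i) x = 2%N.
  move=> xl ll; have [yl yx] := yP i; have [qm qy] := qP i.
  exact: (nearest2 hhex ll (nesym (mln i)) xl (xln i) yl (ym i) qm yx qy).
have q2 i : d (q i) x = 2%N.
  have [l xl ll] := ex_other_line hord x (ln i); exact: (far i l xl ll).2.
(* One step beyond [q ord0] along a new line leads to a point opposite to [x]. *)
have [m' qm' mm'] := ex_other_line hord (q ord0) (m ord0).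
have [um _ uq _ _ _] := matesP hord qm'.
exists y q (mate1 inc (q ord0) m').
- by move=> i; exists (ln i) => //; case: (yP i).
- by move=> i; rewrite pdist_sym.
- move=> i j; have [yl yx] := yP i; have [qm qy] := qP j.
  have [->|ij] := eqVneq i j.
    by rewrite (col_on (nesym (qP j).2) (ym j) qm).
  have [[_ h] _] : nearest inc (q j) (ln i) x /\ d (q j) x = 2%N.
    by apply: far => // /ln_inj/eqP; rewrite (negPf ij).
  by rewrite pdist_sym (h _ yl yx) q2.
- have [yl yx] := yP ord0; have [qm qy] := qP ord0.
  have [[_ h] u2] := nearest2 hhex (nesym (mln ord0)) (nesym mm') yl (ym ord0) qm
    qm' um qy uq.
  by rewrite pdist_sym (h _ (xln _) (nesym yx)) u2.
Qed.

Definition pts k (z : 'I_k -> X) : 'M['F_2]_(k, n) := \matrix_i pt (z i).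

Lemma pts_opp k k' (z : 'I_k -> X) (w : 'I_k' -> X) i j :
  (pts z *m opp_mx inc *m (pts w)^T) i j = (d (z i) (w j) == 3%N)%:R.
Proof. by rewrite form_rows !rowK form_pt. Qed.

Lemma opp_rank (x : X) : (26 <= \rank (opp_mx inc))%N.
Proof.
have [y q u yl q2 yq u3] := dual_pointsP x.
pose ap (i : 'I_(1 + 8)) := if split i is inr j then y j else x.
pose dp (i : 'I_(1 + 8)) := if split i is inr j then q j else u.
have apl i : exists2 l, inc x l & inc (ap i) l.
  rewrite /ap; case: split => [_|j]; last exact: yl.
  by have [l xl _] := yl ord0; exists l.
have [l1 xl1 _] := yl ord0; have [l2 xl2 l21] := ex_other_line hord x l1.
have [f1 tf1] := ex_tail hord xl1; have [f2 tf2] := ex_tail hord xl2.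
have [U [U' UU]] := rank_factor (tails_rank hhex hord R xl1 xl2 (nesym l21) tf1 tf2).
(* Distributing [U] and [U'] over the two sides makes [S] and [T] pair through the identity of size
   4. *)
pose S := U *m tails_mx inc x l1 f1; pose T := U'^T *m tails_mx inc x l2 f2.
have tails_ap l f : inc x l -> tail inc x l f ->
    tails_mx inc x l f *m opp_mx inc *m (pts ap)^T = 0.
  move=> xl tf; apply/matrixP => i j; rewrite form_rows [row j _]rowK mxE.
  by have [m xm am] := apl j; exact: (form_tail_near hhex hord _ xl tf xm am).
have tails_self l f : inc x l -> tail inc x l f ->
    tails_mx inc x l f *m opp_mx inc *m (tails_mx inc x l f)^T = 0.
  by move=> xl tf; apply/matrixP => i j; rewrite form_rows form_tail_self // mxE.
apply: (@rank_hyperbolic _ n (1 + 8) 4 (opp_mx inc) (pts ap) (pts dp) S T).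
- exact: opp_mx_sym.
- apply/matrixP => i j; rewrite pts_opp mxE.
  have [l xl al] := apl i; have [m xm am] := apl j.
  suff le2 : (d (ap i) (ap j) <= 2)%N by rewrite ltn_eqF.
  have [->|/eqP ix] := eqVneq (ap i) x; first by rewrite (leq_trans (pdist_on xm am)).
  have [->|/eqP jx] := eqVneq (ap j) x; first by rewrite (leq_trans (pdist_on al xl)).
  apply: (@pdist_le2 _ _ inc _ _ x); rewrite -pdist_eq1.
    by rewrite (col_on ix al xl).
  by rewrite (col_on (nesym jx) xm am).
- by rewrite -!mulmxA (mulmxA (tails_mx _ _ _ _)) tails_ap // mulmx0.
- by rewrite -!mulmxA (mulmxA (tails_mx _ _ _ _)) tails_ap // mulmx0.
- rewrite trmx_mul -!mulmxA (mulmxA (tails_mx _ _ _ _)) (mulmxA (_ *m opp_mx _)).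
  by rewrite tails_self // mul0mx mulmx0.
- rewrite trmx_mul -!mulmxA (mulmxA (tails_mx _ _ _ _)) (mulmxA (_ *m opp_mx _)).
  by rewrite tails_self // mul0mx mulmx0.
- by rewrite trmx_mul trmxK !mulmxA; rewrite !mulmxA in UU.
(* Block triangular, since [x] is at distance 2 from every [q j]. *)
have -> : pts ap *m opp_mx inc *m (pts dp)^T =
    block_mx 1%:M 0 (\matrix_(i, j) (d (y i) u == 3%N)%:R) (\matrix_(i, j) (i != j)%:R).
  apply/matrixP => i j; rewrite pts_opp /ap /dp.
  case: (split_ordP i) => {}i ->; case: (split_ordP j) => {}j ->;
    rewrite ?block_mxEul ?block_mxEur ?block_mxEdl ?block_mxEdr ?unsplitK !mxE.
  - by rewrite u3 !ord1.
  - by rewrite q2.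
  - by [].
  - by rewrite yq.
by rewrite unitmxE det_lblock det1 mul1r -unitmxE all_ones_sub1_unit.
Qed.

End OppRank.

(** * Duality *)

Lemma rank_sum_le (K : fieldType) m n (I : finType) (P : pred I) (A : I -> 'M[K]_(m, n)) :
  (\rank (\sum_(i | P i) A i)%R <= \sum_(i | P i) \rank (A i))%N.
Proof.
elim/big_rec2: _ => [|i a b _ le]; first by rewrite mxrank0.
by apply: leq_trans (mxrank_add _ _) _; rewrite leq_add2l.
Qed.

Lemma F2_int_odd (m : int) : m%:~R = 1 :> 'F_2 -> exists k, m = 2 * k + 1.
Proof.
move=> m1; exists (m %/ 2)%Z; have := divz_eq m 2.
have : (m %% 2)%Z = 0 \/ (m %% 2)%Z = 1 by lia.
case=> -> E; last by lia.
have two0 : 2%:~R = 0 :> 'F_2 by apply/val_inj.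
by move: m1; rewrite E addr0 rmorphM /= two0 mulr0.
Qed.

Section Lattice.
Variables (R : realType) (X L : finType) (inc : X -> L -> bool).
Hypothesis hhex : generalized_hexagon inc.
Hypothesis hord : has_order inc 2 8.
Local Notation d := (pdist inc).
Local Notation n := #|X|.
Local Notation v := (vec R inc).
Local Notation Lam := (Lambda R inc).

Definition vecs : 'M[R]_n := \matrix_(i, j) v (enum_val j) i 0.

Lemma mul_vecs (c : 'cV[R]_n) : vecs *m c = \sum_z c (enum_rank z) 0 *: v z.
Proof.
rewrite (reindex _ (onW_bij _ (enum_val_bij X))) /=.
apply/matrixP => i j; rewrite ord1 mxE summxE; apply: eq_bigr => k _.
by rewrite !mxE enum_valK mulrC.
Qed.

Lemma Lambda_vecs (a : 'cV[int]_n) : Lam (vecs *m map_mx intr a).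
Proof.
exists (fun z => a (enum_rank z) 0); rewrite mul_vecs.
by apply: eq_bigr => z _; rewrite mxE.
Qed.

Lemma LambdaP y : Lam y <-> exists a : 'cV[int]_n, y = vecs *m map_mx intr a.
Proof.
split=> [[a ->]|[a ->]]; last exact: Lambda_vecs.
exists (\col_i a (enum_val i)); rewrite mul_vecs.
by apply: eq_bigr => z _; rewrite !mxE enum_rankK.
Qed.

Lemma Lambda0 : Lam 0.
Proof. by apply/LambdaP; exists 0; rewrite map_mx0 mulmx0. Qed.

Lemma LambdaD y z : Lam y -> Lam z -> Lam (y + z).
Proof.
move=> /LambdaP[a ->] /LambdaP[b ->]; apply/LambdaP; exists (a + b).
by rewrite map_mxD mulmxDr.
Qed.

Lemma LambdaZ (m : int) y : Lam y -> Lam (m%:~R *: y).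
Proof.
move=> /LambdaP[a ->]; apply/LambdaP; exists (m *: a).
by rewrite map_mxZ scalemxAr.
Qed.

Lemma Lambda_int c y : c \is a Num.int -> Lam y -> Lam (c *: y).
Proof. by move=> /intrP[m ->]; exact: LambdaZ. Qed.

Lemma Lambda_vec z : Lam (v z).
Proof.
apply/LambdaP; exists (delta_mx (enum_rank z) 0).
rewrite map_delta_mx -colE; apply/matrixP => i j.
by rewrite ord1 [RHS]mxE [RHS]mxE enum_rankK.
Qed.

Lemma Lambda_mate_diff p l : Lam (mate_diff R inc p l).
Proof.
have := LambdaZ (-1) (Lambda_vec (mate2 inc p l)).
rewrite mulrN1z scaleN1r; exact: LambdaD (Lambda_vec _).
Qed.

Lemma gram_vecs :
  vecs^T *m vecs =
  3^-1 *: map_mx intr (\matrix_(i, j) gram_val (d (enum_val i) (enum_val j))).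
Proof.
apply/matrixP => i j; rewrite !mxE mulrC -(gram R hhex hord).
by apply: eq_bigr => k _; rewrite !mxE.
Qed.

(** The frame expansion writes [vecs] as a sum of $1 + 25$ matrices of rank at most one. *)
Lemma vecs_rank (x : X) : (\rank vecs <= 26)%N.
Proof.
have [l1 xl1] := ex_line hord x.
pose F (f : X * L) := mate_diff R inc f.1 f.2.
have -> : vecs = v x *m (\row_j (3 / 8 * inner (v (enum_val j)) (v x))) +
    \sum_(f | frame inc x l1 f) F f *m (\row_j (inner (v (enum_val j)) (F f) / 8)).
  apply/matrixP => i j; rewrite [LHS]mxE (frame_vec R hhex hord xl1) [LHS]mxE [RHS]mxE.
  congr (_ + _).
    by rewrite [LHS]mxE [RHS]mxE big_ord1 [X in _ = _ * X]mxE mulrC.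
  rewrite !summxE; apply: eq_bigr => f _.
  by rewrite [LHS]mxE [RHS]mxE big_ord1 [X in _ = _ * X]mxE mulrC.
apply: leq_trans (mxrank_add _ _) _; rewrite -[26%N]/(1 + 25)%N leq_add //.
  by rewrite (leq_trans (mxrankM_maxl _ _)) // rank_leq_col.
apply: leq_trans (rank_sum_le _ _) _.
apply: (@leq_trans (\sum_(f | frame inc x l1 f) 1)%N).
  by apply: leq_sum => f _; rewrite (leq_trans (mxrankM_maxl _ _)) // rank_leq_col.
have := sum_frame hord xl1 (fun=> 1%N : nat).
rewrite -addrA -(sum_tail hord (fun=> 1%N : nat) xl1) (sum_tail_const hord _ xl1).
by rewrite (sum_lines_const hord) => card25; apply: eq_leq; exact: card25.
Qed.

Lemma span_vecs y : real_span Lam y -> exists r, y = vecs *m r.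
Proof.
case=> k [c [z [zL ->]]].
have /fin_all_exists[a za] i : exists a : 'cV[int]_n, z i = vecs *m map_mx intr a.
  exact/LambdaP.
exists (\sum_i c i *: map_mx intr (a i)); rewrite mulmx_sumr.
by apply: eq_bigr => i _; rewrite za scalemxAr.
Qed.

(** The factor 8 clears the denominators in the frame expansion, since [y] pairs integrally with the
    frame. *)
Lemma dual_frame (x : X) y : dual_lattice Lam y -> Lam (8 *: y).
Proof.
move=> [/span_vecs[r yr] yint]; have [l1 xl1] := ex_line hord x.
have {r yr} yE : y = frame_proj inc x l1 y.
  by rewrite yr mul_vecs; exact: (frame_span hhex hord xl1).
rewrite {1}yE /frame_proj scalerDr scaler_sumr; apply: LambdaD.
  have -> : 8 *: ((3 / 8 * inner y (v x)) *: v x) = (3 * inner y (v x)) *: v x.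
    by rewrite scalerA; congr (_ *: _); field.
  apply: Lambda_int (Lambda_vec x); apply: rpredM; first exact: (rpred_nat _ 3).
  exact/yint/Lambda_vec.
apply: (big_ind Lam); [exact: Lambda0 | exact: LambdaD | move=> f _].
rewrite scalerA (_ : 8 * (_ / 8) = inner y (mate_diff R inc f.1 f.2)); last by field.
by apply: Lambda_int (Lambda_mate_diff _ _); apply: yint; exact: Lambda_mate_diff.
Qed.

(** Lifting [U] and [U'] to the integers gives a 26 x 26 matrix [P], the identity modulo 2, so of
    odd determinant. The 26 columns of [W] then span the same space as all [v z], and Cramer's rule
    makes [\det P] times the coordinates of [y] integral. *)
Lemma dual_odd (x : X) y : dual_lattice Lam y ->
  exists k : int, Lam ((2 * k + 1)%:~R *: y).
Proof.
move=> [/span_vecs[r yr] yint].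
have [U [U' UU]] := rank_factor (opp_rank R hhex hord x).
pose lift m p (A : 'M['F_2]_(m, p)) : 'M[int]_(m, p) :=
  map_mx (fun a : 'F_2 => (nat_of_ord a)%:Z) A.
have liftK m p (A : 'M['F_2]_(m, p)) : map_mx intr (lift _ _ A) = A.
  by apply/matrixP => i j; rewrite !mxE /= -[RHS]natr_Zp.
pose M : 'M[int]_n := \matrix_(i, j) gram_val (d (enum_val i) (enum_val j)).
have M2 : map_mx intr M = opp_mx inc.
  apply/matrixP => i j; rewrite !mxE.
  case: (d _ _) (pdist_le3 inc (enum_val i) (enum_val j)) => [|[|[|[|//]]]] _;
    by apply/val_inj.
pose P := lift _ _ U *m M *m lift _ _ U'.
have /F2_int_odd[k detP] : (\det P)%:~R = 1 :> 'F_2.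
  by rewrite -det_map_mx !map_mxM !liftK M2 UU det1.
exists k; rewrite -detP.
pose toR m p (A : 'M[int]_(m, p)) : 'M[R]_(m, p) := map_mx intr A.
pose W := vecs *m toR _ _ (lift _ _ U').
have PR : toR _ _ P = 3 *: (toR _ _ (lift _ _ U) *m vecs^T *m W).
  rewrite /W -!mulmxA (mulmxA vecs^T) gram_vecs -!scalemxAl -!scalemxAr scalerA.
  by rewrite mulfV ?pnatr_eq0 // scale1r /toR /P !map_mxM !mulmxA.
have detP0 : (\det P)%:~R != 0 :> R by rewrite detP intr_eq0; lia.
have Punit : toR _ _ P \in unitmx by rewrite unitmxE det_map_mx unitfE.
have WV : (W^T <= vecs^T)%MS by rewrite trmx_mul submxMl.
(* By dimension: [vecs] has rank at most 26, and [W] at least 26 as [P] is invertible. *)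
have /submxP[Y VY] : (vecs^T <= W^T)%MS.
  rewrite -(mxrank_leqif_sup WV) !mxrank_tr eqn_leq.
  rewrite -{1}(mxrank_tr W) -(mxrank_tr vecs) mxrankS //=.
  rewrite mxrank_tr (leq_trans (vecs_rank x)) //.
  rewrite -[leqLHS](mxrank_unit Punit) PR mxrank_scale_nz ?pnatr_eq0 //.
  exact: mxrankM_maxr.
have /(congr1 trmx) := VY; rewrite trmxK trmx_mul trmxK => {VY}VY.
pose c := Y^T *m r.
have yW : y = W *m c by rewrite yr {1}VY mulmxA.
have [t tE] : exists t : 'cV[int]_n, vecs^T *m y = toR _ _ t.
  have /fin_all_exists[t tE] (i : 'I_n) :
      exists m : int, inner y (v (enum_val i)) = m%:~R.
    by apply/intrP/yint; exact: Lambda_vec.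
  exists (\col_i t i); apply/matrixP => i j; rewrite ord1 !mxE -tE innerC.
  by apply: eq_bigr => l _; rewrite !mxE.
have Pc : toR _ _ P *m c = toR _ _ (3 *: (lift _ _ U *m t)).
  rewrite PR -scalemxAl -mulmxA -yW -mulmxA tE /toR map_mxZ map_mxM.
  by congr (_ *: _).
have detc : (\det P)%:~R *: c = toR _ _ (\adj P *m (3 *: (lift _ _ U *m t))).
  rewrite /toR map_mxM -[X in _ *m X]Pc mulmxA -map_mxM mul_adj_mx.
  by rewrite map_scalar_mx mul_scalar_mx.
rewrite yW scalemxAr detc /W -mulmxA /toR -map_mxM; exact: Lambda_vecs.
Qed.

(** Odd squares are 1 modulo 8, so [y] is an integral combination of $8y$ and an odd multiple of
    [y]. *)
Lemma dual_sub_Lambda (x : X) y : dual_lattice Lam y -> Lam y.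
Proof.
move=> yd; have [k yk] := dual_odd x yd; have y8 := dual_frame x yd.
have [m mE] : exists m : int, (2 * k + 1) * (2 * k + 1) = 8 * m + 1.
  have [q [->|->]] : exists q, k = 2 * q \/ k = 2 * q + 1.
    exists (k %/ 2)%Z; lia.
  - by exists (2 * q * q + q); ring.
  - by exists (2 * q * q + 3 * q + 1); ring.
have -> : y = (2 * k + 1)%:~R *: ((2 * k + 1)%:~R *: y) + (- m)%:~R *: (8 *: y).
  rewrite !scalerA -scalerDl -rmorphM mE -[LHS]scale1r; congr (_ *: _).
  by rewrite rmorphD rmorphM rmorphN /=; ring.
by apply: LambdaD; exact: LambdaZ.
Qed.

(** The integers by which the inner products of the [v x] exceed $-1/3$. *)
Definition gram_quo (k : nat) : int :=
  match k with 0 => 3 | 1 => -1 | 2 => 1 | _ => 0 end.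

Lemma gram_valE k : gram_val k = 3 * gram_quo k - 1.
Proof. by case: k => [|[|[|k]]]. Qed.

Lemma inner_comb (a : X -> int) z :
  inner (\sum_x (a x)%:~R *: v x) (v z) =
  (\sum_x a x * gram_quo (d x z))%:~R - (\sum_x a x)%:~R / 3.
Proof.
rewrite inner_suml !rmorph_sum /= mulr_suml -sumrB; apply: eq_bigr => x _.
rewrite (innerZl (a x)%:~R) (gram R hhex hord) gram_valE !rmorphM rmorphB rmorphM /=.
by field.
Qed.

Lemma third_int (m : int) : (m%:~R / 3 : R) \is a Num.int <-> (m = 0 %[mod 3])%Z.
Proof.
split=> [/intrP[q qE]|m0].
  have : m%:~R = (q * 3)%:~R :> R by rewrite rmorphM /= -qE; field.
  by move/intr_inj ->; rewrite modzMl mod0z.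
have -> : m = (m %/ 3)%Z * 3 by have := divz_eq m 3; rewrite m0 mod0z addr0.
by rewrite rmorphM /= mulfK ?pnatr_eq0 //; apply: intr_int.
Qed.

Lemma comb_dual (a : X -> int) : let y := \sum_x (a x)%:~R *: v x in
  (forall z, inner y (v z) \is a Num.int) -> dual_lattice Lam y.
Proof.
move=> y yint; split.
  exists 1%N, (fun=> 1), (fun=> y); rewrite big_ord1 scale1r; split=> // _.
  by exists a.
move=> _ [b ->]; rewrite inner_sumr; apply: rpred_sum => z _.
by rewrite (innerZr (b z)%:~R); apply: rpredM; [exact: intr_int | exact: yint].
Qed.

End Lattice.

Theorem theorem4p3 (R : realType) (X L : finType) (inc : X -> L -> bool)
    (hhex : generalized_hexagon inc) (hord : has_order inc 2 8) :
  L_X R inc = dual_lattice (Lambda R inc).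
Proof.
(* The diameter provides a vertex of the incidence graph; if it is a line, that line has points. *)
have [x _] : exists x : X, True.
  have [[_ [[x|l] _]] _] := hhex; first by exists x.
  have [/(_ l) c3 _] := hord; have : (0 < #|[set x | inc x l]|)%N by rewrite c3.
  by case/card_gt0P => x _; exists x.
rewrite predeqE => y; split=> [[a [a0 ->]]|yd].
  apply: comb_dual => z; rewrite (inner_comb R hhex hord) rpredB ?intr_int //.
  exact/third_int.
(* Whatever the coefficients [a], pairing with the single vector of [x] forces their sum to vanish
   modulo 3. *)
have [a yE] := dual_sub_Lambda hhex hord x yd; exists a; split=> //.
apply/(third_int R); have := yd.2 (vec R inc x) (Lambda_vec _ _ _).
rewrite yE (inner_comb R hhex hord) => h.
have := rpredB (intr_int R (\sum_z a z * gram_quo (pdist inc z x))) h.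
by rewrite opprB addrC subrK.
Qed.
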